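(* Let $(\Omega,m,\sigma,\mathcal{J}_0,T,\mathcal{B},\mathcal{L}_0,\nu_0,\varphi_0,H_\epsilon)$ be a random open system whose holes are the exceedance sets $H_{\omega,\epsilon_N}=\{x\in\mathcal{J}_{\omega,0}:h_\omega(x)>z_{\omega,N}\}$, and assume that (C1'), (C2), (C3), (C4'), (C5'), (C7'), (C8) and (S) hold. Then for $m$-a.e. $\omega\in\Omega$ $$\lim_{N\to\infty}\nu_{\omega,0}\bigl(X_{\omega,N-1,\epsilon_N}\bigr)=\lim_{N\to\infty}\mu_{\omega,0}\bigl(X_{\omega,N-1,\epsilon_N}\bigr)=\lim_{N\to\infty}\frac{\lambda^N_{\omega,\epsilon_N}}{\lambda^N_{\omega,0}}=\exp\left(-\int_\Omega t_\omega\theta_{\omega,0}\,dm(\omega)\right),$$ where $X_{\omega,N-1,\epsilon_N}=\{x\in\mathcal{J}_{\omega,0}:h_{\sigma^j\omega}(T_\omega^j(x))\le z_{\sigma^j\omega,N},\ j=0,\dots,N-1\}$ and $\theta_{\omega,0}=1-\sum_{k=0}^\infty\hat q^{(k)}_{\omega,0}$.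
   Context: Random open systems. $(\Omega,\mathscr{F},m)$ is a probability space and $\sigma:\Omega\to\Omega$ is an invertible, ergodic, $m$-preserving map. $X$ is a complete metrizable space with Borel $\sigma$-algebra $\mathscr{B}$; for each $\omega$, $\mathcal{J}_{\omega,0}\subseteq X$ is closed, $\omega\mapsto\mathcal{J}_{\omega,0}$ is a closed random set (i.e. measurable), and $T_\omega:\mathcal{J}_{\omega,0}\to\mathcal{J}_{\sigma\omega,0}$ is a map. Put $T_\omega^n=T_{\sigma^{n-1}\omega}\circ\cdots\circ T_\omega$, $\mathcal{J}_0=\bigcup_{\omega}\{\omega\}\times\mathcal{J}_{\omega,0}$ and $T(\omega,x)=(\sigma\omega,T_\omega(x))$ on $\mathcal{J}_0$. A random (probability) measure $\mu=\{\mu_\omega\}$ is a measure on $\Omega\times X$ with marginal $m$, identified with its disintegration into fibre (probability) measures $\mu_\omega$. $\{\mathcal{B}_\omega\}$ are Banach spaces of real-valued functions on $\mathcal{J}_{\omega,0}$, $g_{\omega,0}\in\mathcal{B}_\omega$ are weights, and $\mathcal{L}_{\omega,0}f(x)=\sum_{y\in T_\omega^{-1}(x)}f(y)g_{\omega,0}(y)$ is a well-defined operator $\mathcal{B}_\omega\to\mathcal{B}_{\sigma\omega}$. $\mathcal{B}$ is the space of $f:\mathcal{J}_0\to\mathbb{R}$ with $f_\omega\in\mathcal{B}_\omega$ for each $\omega$, and $(\mathcal{L}_0f)_\omega=\mathcal{L}_{\sigma^{-1}\omega,0}f_{\sigma^{-1}\omega}$. For a hole parameter $\epsilon$, $H_\epsilon\subseteq\mathcal{J}_0$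 is a measurable set with fibres $H_{\omega,\epsilon}\subseteq\mathcal{J}_{\omega,0}$; $\mathcal{J}_{\omega,\epsilon}=\mathcal{J}_{\omega,0}\setminus H_{\omega,\epsilon}$; $X_{\omega,N,\epsilon}=\{x\in\mathcal{J}_{\omega,0}:T_\omega^j(x)\notin H_{\sigma^j\omega,\epsilon},\ 0\le j\le N\}$; $X_{\omega,\infty,\epsilon}=\bigcap_{N\ge 0}X_{\omega,N,\epsilon}$; $\mathcal{L}_{\omega,\epsilon}(f)=\mathcal{L}_{\omega,0}(f\mathbf{1}_{\mathcal{J}_{\omega,\epsilon}})$. For operators, $A_\omega^n=A_{\sigma^{n-1}\omega}\circ\cdots\circ A_\omega$; for scalars, $\lambda^n_{\omega,\epsilon}=\prod_{j=0}^{n-1}\lambda_{\sigma^j\omega,\epsilon}$. The tuple is a random open system if: (M1) $T:\mathcal{J}_0\to\mathcal{J}_0$ is measurable for $\mathscr{F}\otimes\mathscr{B}$; (M2) for every measurable $h\in\mathcal{B}$ the map $(\omega,x)\mapsto(\mathcal{L}_0h)_\omega(x)$ is measurable; (CCM) there are a random probability measure $\nu_0=\{\nu_{\omega,0}\}$ on $\mathcal{J}_0$ and measurable $\lambda_0:\Omega\to\mathbb{R}\setminus\{0\}$, $\varphi_0:\mathcal{J}_0\to(0,\infty)$ with $\mathcal{L}_{\omega,0}(\varphi_{\omega,0})=\lambda_{\omega,0}\varphi_{\sigma\omega,0}$ and $\nu_{\sigma\omega,0}(\mathcal{L}_{\omega,0}(f))=\lambda_{\omega,0}\nu_{\omega,0}(f)$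 for all $f\in\mathcal{B}_\omega$; the $\nu_{\omega,0}$ are non-atomic, $\lambda_{\omega,0}=\nu_{\sigma\omega,0}(\mathcal{L}_{\omega,0}\mathbf{1})$ and $\log\lambda_{\omega,0}\in L^1(m)$; $\mu_{\omega,0}(f):=\int f\varphi_{\omega,0}\,d\nu_{\omega,0}$ defines a ($T$-invariant) random probability measure $\mu_0$; (B) $\mathcal{B}_\omega\subseteq L^\infty(\nu_{\omega,0})$ and there is a measurable $m$-a.e. finite $K:\Omega\to[1,\infty)$ with $\|f\|_{\infty,\omega}\le K_\omega\|f\|_{\mathcal{B}_\omega}$, where $\|\cdot\|_{\infty,\omega}$ is the $L^\infty(\nu_{\omega,0})$ norm; (A) the holes are decreasing: $H_{\epsilon'}\subseteq H_\epsilon$ for $0<\epsilon'\le\epsilon$; (X) for all sufficiently small $\epsilon>0$, $X_{\omega,\infty,\epsilon}\ne\emptyset$ for $m$-a.e. $\omega$. Observations and thresholds. $h_\omega:\mathcal{J}_{\omega,0}\to\mathbb{R}$ is continuous with $\nu_{\omega,0}$-essential infimum $\underline z_\omega$ strictly smaller than its $\nu_{\omega,0}$-essential supremum $\overline z_\omega$ for $m$-a.e. $\omega$, and $\nu_{\omega,0}(\{h_\omega>\overline z_\omega\})=0$. Thresholds $z_{\omega,N}\in[\underline z_\omega,\overline z_\omega]$ are increasing in $N$. The holes form a decreasing sequence $H_{\omega,\epsilon_N}=\{x:h_\omega(x)>z_{\omega,N}\}$; $\epsilon_N$ is merely an index, so in the conditions ''$\epsilon\ge0$'' ranges over $0$ and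 the $\epsilon_N$, and ''$\epsilon\to0$'' / ''small $\epsilon$'' mean $N\to\infty$ / large $N$. $\Omega_+=\{\omega:\mu_{\omega,0}(H_{\omega,\epsilon})>0\text{ for all }\epsilon>0\}$. For $\mu_{\omega,0}(H_{\omega,\epsilon})>0$, $k\ge0$, $$\hat q^{(k)}_{\omega,\epsilon}=\frac{\mu_{\sigma^{-(k+1)}\omega,0}\Bigl(T^{-(k+1)}_{\sigma^{-(k+1)}\omega}(H_{\omega,\epsilon})\cap\bigcap_{j=1}^kT^{-(k+1)+j}_{\sigma^{-(k+1)}\omega}(H^c_{\sigma^{-j}\omega,\epsilon})\cap H_{\sigma^{-(k+1)}\omega,\epsilon}\Bigr)}{\mu_{\sigma^{-(k+1)}\omega,0}\bigl(T^{-(k+1)}_{\sigma^{-(k+1)}\omega}(H_{\omega,\epsilon})\bigr)}.$$ Conditions: (S) A random scaling function $t\in L^\infty(m)$ with $t>0$ is fixed, and $z_N,\xi_N\in L^\infty(m)$ and $W<\infty$ satisfy $\mu_{\omega,0}(\{h_\omega(x)-z_{\omega,N}>0\})=(t_\omega+\xi_{\omega,N})/N$ for a.e. $\omega$ and each $N\ge1$, where (i) $\lim_{N\to\infty}\xi_{\omega,N}=0$ for a.e. $\omega$ and (ii) $|\xi_{\omega,N}|\le W$ for a.e. $\omega$ and all $N\ge1$. (C1') There is $C_1\ge1$ with $C_1^{-1}\le\mathcal{L}_{\omega,0}\mathbf{1}\le C_1$ for $m$-a.e. $\omega$. (C2) For each $\epsilon\ge0$ there are a random measure $\{\nu_{\omega,\epsilon}\}$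 supported in $\mathcal{J}_0$ and measurable $\lambda_\epsilon:\Omega\to(0,\infty)$ with $\log\lambda_{\omega,\epsilon}\in L^1(m)$ and $\varphi_\epsilon:\mathcal{J}_0\to\mathbb{R}$ with $\mathcal{L}_{\omega,\epsilon}(\varphi_{\omega,\epsilon})=\lambda_{\omega,\epsilon}\varphi_{\sigma\omega,\epsilon}$, $\nu_{\sigma\omega,\epsilon}(\mathcal{L}_{\omega,\epsilon}(f))=\lambda_{\omega,\epsilon}\nu_{\omega,\epsilon}(f)$ for all $f\in\mathcal{B}_\omega$, and, $m$-a.e., $\nu_{\omega,0}(\varphi_{\omega,\epsilon})=1$, $\nu_{\omega,0}(\mathbf{1})=1$. (C3) There are operators $Q_{\omega,\epsilon}:\mathcal{B}_\omega\to\mathcal{B}_{\sigma\omega}$ such that, for $m$-a.e. $\omega$ and all $f\in\mathcal{B}_\omega$, $\lambda_{\omega,\epsilon}^{-1}\mathcal{L}_{\omega,\epsilon}(f)=\nu_{\omega,\epsilon}(f)\varphi_{\sigma\omega,\epsilon}+Q_{\omega,\epsilon}(f)$, $Q_{\omega,\epsilon}(\varphi_{\omega,\epsilon})=0$, $\nu_{\sigma\omega,\epsilon}(Q_{\omega,\epsilon}(f))=0$. (C4') For each $f\in\mathcal{B}$ and $N\in\mathbb{N}$ there are $C_f>0$ and $\alpha(N)>0$ (independent of $\omega$) with $\sum_{N=1}^\infty\alpha(N)<\infty$ such that for $m$-a.e. $\omega$ and all $N$, $\sup_{\epsilon\ge0}\|Q^N_{\omega,\epsilon}f_\omega\|_{\infty,\sigma^N\omega}\le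 C_f\alpha(N)\|f_\omega\|_{\mathcal{B}_\omega}$. (C5') There is $C_2\ge1$ with $\sup_{\epsilon\ge0}\|\varphi_{\omega,\epsilon}\|_{\infty,\omega}\le C_2$ and $\|\varphi_{\omega,0}\|_{\mathcal{B}_\omega}\le C_2$ for $m$-a.e. $\omega$. (C7') There is $C_3\ge1$ such that for all sufficiently small $\epsilon>0$, $\operatorname{ess\,inf}_\omega\inf\varphi_{\omega,0}\ge C_3^{-1}>0$ and $\operatorname{ess\,inf}_\omega\inf\varphi_{\omega,\epsilon}\ge0$. (C8) For $m$-a.e. $\omega\in\Omega_+$ the limit $\hat q^{(k)}_{\omega,0}:=\lim_{\epsilon\to0}\hat q^{(k)}_{\omega,\epsilon}$ exists for each $k\ge0$.
   Formalization: The formal theorem also assumes, for a.e. ω, the conformality identity ν_{σω,0}(L_{ω,0}g)=λ_{ω,0}ν_{ω,0}(g) for g=f·1_{X_{ω,n,ε}}, f∈B_ω, not only for g∈B_ω; without it the claim fails (a Markov-chain shift gives e^{-1} instead of e^{-1/2}). *)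

(* Defs.v *)
From HB Require Import structures.
From mathcomp Require Import all_boot all_order all_algebra.
From mathcomp Require Import all_classical all_reals all_analysis.
From mathcomp Require Import ess_sup_inf measurable_realfun.

Set Implicit Arguments.
Unset Strict Implicit.
Unset Printing Implicit Defensive.

Import Order.TTheory GRing.Theory Num.Theory.
Import numFieldNormedType.Exports.

Local Open Scope classical_set_scope.
Local Open Scope ring_scope.

Notation Borel X := (g_sigma_algebraType (@open X)).

(* Unordered sum of a real family over an arbitrary set; it is the sum of the
   family when the family is [summable], and is only used in that case. *)
Definition tsum (R : realType) (I : choiceType) (D : set I) (a : I -> R) : R :=
  fine (\esum_(i in D) (Num.max (a i) 0)%:E) -
  fine (\esum_(i in D) (Num.max (- a i) 0)%:E).

Definition nonatomic (d : measure_display) (T : measurableType d)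
    (R : realType) (mu : {measure set T -> \bar R}) : Prop :=
  forall A, measurable A -> (0 < mu A)%E ->
    exists B, [/\ measurable B, B `<=` A, (0 < mu B)%E & (mu B < mu A)%E].

Definition ergodic (d : measure_display) (T : measurableType d)
    (R : realType) (m : probability T R) (s : T -> T) : Prop :=
  forall A, measurable A -> s @^-1` A = A -> m A = 0%E \/ m A = 1%E.

(* The hole parameter is encoded by a natural number: index 0 stands for
   epsilon = 0 (the closed system, with empty hole), and index N >= 1 stands
   for epsilon_N.  Hence "for all epsilon >= 0" is quantification over nat,
   "for all epsilon > 0" is quantification over N >= 1, and "epsilon -> 0" is
   N --> oo.

   A real function on the fibre J_w is represented by its extension by zero to
   X.  The Banach space B_w is a complete normed module whose elements are
   turned into such functions by [ev w].  Random measures are given by their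
   disintegrations, i.e. by kernels from Omega to X.  The observables [obs] are
   only relevant on J_w, the thresholds [thr N] only for N >= 1. *)
Record open_data (R : realType) (d : measure_display) (Omega : measurableType d)
    (X : completePseudoMetricType R) := OpenData {
  sigma : Omega -> Omega ;
  sigmaV : Omega -> Omega ;
  J : Omega -> set X ;
  Tmap : Omega -> X -> X ;
  B : Omega -> completeNormedModType R ;
  ev : forall w, B w -> X -> R ;
  weight : forall w, B w ;
  nu : nat -> R.-ker Omega ~> Borel X ;
  lam : nat -> Omega -> R ;
  phi : nat -> forall w, B w ;
  obs : Omega -> X -> R ;
  thr : nat -> Omega -> R }.

Arguments ev {R d Omega X} o {w} f x.

Section Constructions.
Context (R : realType) (d : measure_display) (Omega : measurableType d)
  (X : completePseudoMetricType R) (m : probability Omega R)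
  (S : open_data Omega X).

Local Notation sg := (sigma S).
Local Notation sgV := (sigmaV S).

Fixpoint Titer (n : nat) (w : Omega) (x : X) : X :=
  if n is n'.+1 then Tmap S (iter n' sg w) (Titer n' w x) else x.

Definition J0 : set (Omega * Borel X) := [set p | J S p.1 p.2].

(* Measurability on J0 for the trace of the product sigma-algebra; the
   library's [measurable_fun J0 f] would hold vacuously if J0 itself were not
   known to be measurable. *)
Definition measurable_on_J0 (d' : measure_display) (U : measurableType d')
    (f : Omega * Borel X -> U) : Prop :=
  forall Y, measurable Y -> strace measurable J0 (J0 `&` f @^-1` Y).

Definition hole (w : Omega) (N : nat) : set X :=
  [set x | [/\ (0 < N)%N, J S w x & thr S N w < obs S w x]].

Definition surv (w : Omega) (n N : nat) : set X :=
  [set x | J S w x /\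
    forall j, (j <= n)%N -> ~ hole (iter j sg w) N (Titer j w x)].

Definition survoo (w : Omega) (N : nat) : set X := \bigcap_n surv w n N.

Definition fibre (w : Omega) (x : X) : set X :=
  [set y | J S w y /\ Tmap S w y = x].

Definition transfer (w : Omega) (f : X -> R) (x : X) : R :=
  tsum (fibre w x) (fun y => f y * ev S (weight S w) y).

Definition open_transfer (w : Omega) (N : nat) (f : X -> R) : X -> R :=
  transfer w (fun y => f y * \1_(J S w `\` hole w N) y).

Definition mu (w : Omega) (A : set (Borel X)) : \bar R :=
  (\int[nu S 0 w]_(x in A) (ev S (phi S 0 w) x)%:E)%E.

Definition lamn (n : nat) (w : Omega) (N : nat) : R :=
  \prod_(j < n) lam S N (iter j sg w).

Definition Linfty_norm (w : Omega) (f : X -> R) : \bar R :=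
  Lnorm (nu S 0 w : {measure set (Borel X) -> \bar R}) +oo%E (EFin \o f).

Definition Omega_plus : set Omega :=
  [set w | forall N, (0 < N)%N -> (0 < mu w (hole w N))%E].

Definition qhat (k N : nat) (w : Omega) : R :=
  let w' := iter k.+1 sgV w in
  let hit := [set x | J S w' x /\ hole w N (Titer k.+1 w' x)] in
  let avoid := [set x | forall j, (1 <= j <= k)%N ->
                  ~ hole (iter j sgV w) N (Titer (k.+1 - j) w' x)] in
  fine (mu w' (hit `&` avoid `&` hole w' N)) / fine (mu w' hit).

Definition qhat0 (k : nat) (w : Omega) : R :=
  limn (fun N => qhat k N w).

Definition theta0 (w : Omega) : R :=
  1 - limn (series (fun k => qhat0 k w)).

Record base_system : Prop := BaseSystem {
  sigmaK : cancel sg sgV ;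
  sigmaVK : cancel sgV sg ;
  sigma_meas : measurable_fun setT sg ;
  sigmaV_meas : measurable_fun setT sgV ;
  sigma_mp : forall A, measurable A -> m (sg @^-1` A) = m A ;
  sigma_ergodic : ergodic m sg ;
  J_closed : forall w, closed (J S w) ;
  J_meas : forall U : set X, open U ->
    measurable [set w | J S w `&` U !=set0] ;
  T_maps : forall w x, J S w x -> J S (sg w) (Tmap S w x) }.

(* [one_in]: L_{w,0} 1 is part of the theory, so 1 belongs to B_w. *)
Record function_spaces : Prop := FunctionSpaces {
  ev_linear : forall w a (f g : B S w) x,
    ev S (a *: f + g) x = a * ev S f x + ev S g x ;
  ev_inj : forall w, injective (@ev _ _ _ _ S w) ;
  ev_out : forall w (f : B S w) x, ~ J S w x -> ev S f x = 0 ;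
  one_in : forall w, exists f : B S w, ev S f = \1_(J S w) ;
  L0_summable : forall w (f : B S w) x, J S (sg w) x ->
    summable (fibre w x) (fun y => (ev S f y * ev S (weight S w) y)%:E) ;
  L0_maps : forall w (f : B S w),
    exists g : B S (sg w), ev S g = transfer w (ev S f) }.

Record CCM : Prop := MkCCM {
  nu0_prob : forall w, nu S 0 w setT = 1%E ;
  nu0_supp : forall w, nu S 0 w (~` J S w) = 0%E ;
  lam0_meas : measurable_fun setT (lam S 0) ;
  lam0_neq0 : forall w, lam S 0 w != 0 ;
  phi0_meas : measurable_on_J0 (fun p => ev S (phi S 0 p.1) p.2) ;
  phi0_gt0 : forall w x, J S w x -> 0 < ev S (phi S 0 w) x ;
  phi0_eigen : forall w x, J S (sg w) x ->
    transfer w (ev S (phi S 0 w)) x = lam S 0 w * ev S (phi S 0 (sg w)) x ;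
  nu0_conformal : forall w (f : B S w),
    \int[nu S 0 (sg w)]_x transfer w (ev S f) x =
      lam S 0 w * \int[nu S 0 w]_x ev S f x ;
  nu0_nonatomic : forall w, nonatomic (nu S 0 w) ;
  lam0E : forall w, lam S 0 w = \int[nu S 0 (sg w)]_x transfer w (\1_(J S w)) x ;
  lam0_logL1 : m.-integrable setT (fun w => (ln (lam S 0 w))%:E) ;
  mu_prob : forall w, mu w setT = 1%E ;
  mu_inv : {ae m, forall w, forall A : set (Borel X), measurable A ->
    mu w (J S w `&` Tmap S w @^-1` A) = mu (sg w) A } }.

Record random_open_system : Prop := RandomOpenSystem {
  ros_base : base_system ;
  ros_spaces : function_spaces ;
  ros_hole_meas : forall N, strace measurable J0 [set p | hole p.1 N p.2] ;
  ros_M1 : measurable_on_J0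
    (fun p => (sg p.1, Tmap S p.1 p.2) : Omega * Borel X) ;
  ros_M2 : forall h : forall w, B S w,
    measurable_on_J0 (fun p => ev S (h p.1) p.2) ->
    measurable_on_J0
      (fun p => transfer (sgV p.1) (ev S (h (sgV p.1))) p.2) ;
  ros_CCM : CCM ;
  (* [nu0_conformal] at f 1_{X_{w,n,eps}}, which need not lie in B_w.  It is
     needed for nu_0(L_eps^n f) = lam_0^n nu_0(f 1_{X_{n-1,eps}}), where
     L_eps^n f = L_0^n (f 1_{X_{n-1,eps}}), and it does not follow from
     conformality on B_w alone. *)
  ros_conformal_surv : {ae m, forall w, forall (f : B S w) n N,
    \int[nu S 0 (sg w)]_x transfer w (fun y => ev S f y * \1_(surv w n N) y) x =
      lam S 0 w * \int[nu S 0 w]_x (ev S f x * \1_(surv w n N) x)} ;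
  ros_B_Linfty : forall w (f : B S w),
    (ev S f : Borel X -> R) \in
      Lfun (nu S 0 w : {measure set (Borel X) -> \bar R}) +oo%E ;
  ros_B_bound : exists K : Omega -> \bar R,
    [/\ measurable_fun setT K, forall w, (1 <= K w)%E,
        {ae m, forall w, (K w < +oo)%E} &
        forall w (f : B S w), (Linfty_norm w (ev S f) <= K w * `|f|%:E)%E] ;
  ros_A : forall w N N', (0 < N)%N -> (N <= N')%N -> hole w N' `<=` hole w N ;
  ros_X : \forall N \near \oo, {ae m, forall w, survoo w N !=set0} }.

Definition z_inf (w : Omega) : \bar R :=
  ess_inf (nu S 0 w : {measure set (Borel X) -> \bar R}) (EFin \o obs S w).
Definition z_sup (w : Omega) : \bar R :=
  ess_sup (nu S 0 w : {measure set (Borel X) -> \bar R}) (EFin \o obs S w).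

Record exceedance_thresholds : Prop := ExceedanceThresholds {
  obs_cont : forall w, {within J S w, continuous (obs S w)} ;
  z_inf_lt_sup : {ae m, forall w, (z_inf w < z_sup w)%E} ;
  obs_gt_sup : {ae m, forall w,
    nu S 0 w (J S w `&` [set x | (z_sup w < (obs S w x)%:E)%E]) = 0%E} ;
  thr_range : {ae m, forall w, forall N, (0 < N)%N ->
    (z_inf w <= (thr S N w)%:E <= z_sup w)%E} ;
  thr_incr : forall w N N', (0 < N)%N -> (N <= N')%N ->
    thr S N w <= thr S N' w }.

Definition cond_S (t : Omega -> R) : Prop :=
  t \in Lfun m +oo%E /\ {ae m, forall w, 0 < t w} /\
  exists (xi : nat -> Omega -> R) (W : R),
  [/\ forall N, (0 < N)%N -> thr S N \in Lfun m +oo%E /\ xi N \in Lfun m +oo%E,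
      {ae m, forall w, forall N, (0 < N)%N ->
        mu w (hole w N) = ((t w + xi N w) / N%:R)%:E},
      {ae m, forall w, xi ^~ w @ \oo --> (0 : R)} &
      {ae m, forall w, forall N, (0 < N)%N -> `|xi N w| <= W}].

Definition cond_C1' : Prop := exists C1 : R, 1 <= C1 /\
  {ae m, forall w, forall x, J S (sg w) x ->
    C1^-1 <= transfer w (\1_(J S w)) x <= C1}.

Definition cond_C2 : Prop := forall N : nat,
  (forall w, nu S N w (~` J S w) = 0%E) /\
  (forall w (f : B S w), (nu S N w).-integrable setT (EFin \o ev S f)) /\
  [/\ measurable_fun setT (lam S N), forall w, 0 < lam S N w &
      m.-integrable setT (fun w => (ln (lam S N w))%:E)] /\
  measurable_on_J0 (fun p => ev S (phi S N p.1) p.2) /\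
  (forall w x, J S (sg w) x ->
    open_transfer w N (ev S (phi S N w)) x =
      lam S N w * ev S (phi S N (sg w)) x) /\
  (forall w (f : B S w),
    \int[nu S N (sg w)]_x open_transfer w N (ev S f) x =
      lam S N w * \int[nu S N w]_x ev S f x) /\
  {ae m, forall w, \int[nu S 0 w]_x ev S (phi S N w) x = 1} /\
  {ae m, forall w, nu S 0 w (J S w) = 1%E}.

Section Remainder.
Variable Q : nat -> forall w, {linear B S w -> B S (sg w)}.

Fixpoint Qiter (N n : nat) (w : Omega) (f : B S w) : B S (iter n sg w) :=
  if n is n'.+1 then Q N (iter n' sg w) (Qiter N n' f) else f.

Definition cond_C3 : Prop := forall N : nat, {ae m, forall w,
  (forall (f : B S w) x, J S (sg w) x ->
    (lam S N w)^-1 * open_transfer w N (ev S f) x =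
      (\int[nu S N w]_y ev S f y) * ev S (phi S N (sg w)) x
      + ev S (Q N w f) x) /\
  Q N w (phi S N w) = 0 /\
  (forall f : B S w, \int[nu S N (sg w)]_x ev S (Q N w f) x = 0)}.

Definition cond_C4' : Prop := forall f : (forall w, B S w),
  exists (Cf : R) (alpha : nat -> R),
  [/\ 0 < Cf, forall n, (1 <= n)%N -> 0 < alpha n,
      (\sum_(1 <= n <oo) (alpha n)%:E < +oo)%E &
      {ae m, forall w, forall n, (1 <= n)%N ->
        (ereal_sup [set Linfty_norm (iter n sg w) (ev S (Qiter N n (f w)))
                   | N in [set: nat]]
         <= (Cf * alpha n * `|f w|)%:E)%E}].

End Remainder.

Definition cond_C5' : Prop := exists C2 : R, 1 <= C2 /\
  {ae m, forall w,
    (ereal_sup [set Linfty_norm w (ev S (phi S N w)) | N in [set: nat]]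
       <= C2%:E)%E /\ `|phi S 0 w| <= C2}.

Definition inf_phi (N : nat) (w : Omega) : \bar R :=
  ereal_inf [set (ev S (phi S N w) x)%:E | x in J S w].

Definition cond_C7' : Prop := exists C3 : R, 1 <= C3 /\
  \forall N \near \oo,
    ((C3^-1)%:E <= ess_inf m (inf_phi 0))%E /\
    (0 <= ess_inf m (inf_phi N))%E.

Definition cond_C8 : Prop := {ae m, forall w, Omega_plus w ->
  forall k, cvgn (fun N => qhat k N w)}.

End Constructions.

(* Main.v *)
(** Write [q N w = 1 - lam N w / lam 0 w].  By conformality [q N w] is the
    [nu 0 w]-integral of [phi N w] over the hole.  Expanding [phi N w] as the
    normalized image of [phi 0] under [n] steps of the open system started at
    [sigma^-n w], with error [Q^n], turns this integral into the [mu]-measure of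
    the points whose first hit of the hole happens at time [n]; splitting
    according to the previous hit, that measure is [mu w (hole w N)] times
    [1 - \sum_(k < n) qhat k N w].  Letting [N], then [n], go to infinity gives
    [N * q N w --> t w * theta0 w].

    As [N * q N] is bounded, Maker's form of the ergodic theorem yields
    [\sum_(j < N) q N (sigma^j w) --> \int t theta0], hence
    [lamn N w N / lamn N w 0 = \prod_(j < N) (1 - q N (sigma^j w))] tends to
    [expR (- \int t theta0)].  The spectral decomposition of [N] open steps
    identifies the survival probabilities with this product up to a factor
    tending to [1]. *)

Require Import Defs.
From mathcomp Require Import all_boot all_order all_algebra.
From mathcomp Require Import all_classical all_reals all_analysis.
From mathcomp Require Import ess_sup_inf measurable_realfun.
From mathcomp Require Import ring lra.

Set Implicit Arguments.
Unset Strict Implicit.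
Unset Printing Implicit Defensive.

Import Order.TTheory GRing.Theory Num.Theory.
Import numFieldNormedType.Exports.

Local Open Scope classical_set_scope.
Local Open Scope ring_scope.

(** * The maximal ergodic inequality *)

(** The expansion starts at [sigma^-n w] so that the hole stays over the fixed point [w] while the
    number of steps grows. Every bound must then hold along the backward orbit with the same
    constants, and the almost sure hypotheses are transported to the whole two-sided orbit. The
    limits in [N] and [n] cannot simply be exchanged, since neither [N * q N w] nor the series of
    the [qhat0 k w] is known to converge. Both convergences come together, from an error whose main
    term depends on [n] only. The expansion also needs [nu N] to approach [nu 0] on [phi 0]; the
    spectral identity integrated over the whole fibre gives this.

    Maker's form is needed because the summand [N * q N] changes with the length of the sum. Tail
    suprema reduce it to a fixed function, and for that function it is enough that a negative mean
    keeps the Birkhoff sums bounded above. Finally, [theta0] is not assumed measurable, so the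
    integral of the limit is compared with that of a measurable function equal to it almost
    everywhere. *)

Section MeasurePreserving.
Context (R : realType) (d : measure_display) (T : measurableType d)
  (m : probability T R) (s : T -> T) (ms : measurable_fun setT s)
  (mp : forall A, measurable A -> m (s @^-1` A) = m A).

Lemma bounded_measurable_integrable (h : T -> R) (G : R) : measurable_fun setT h ->
  (forall w, `|h w| <= G) -> m.-integrable setT (EFin \o h).
Proof.
move=> mh hG; apply: measurable_bounded_integrable => //.
  by rewrite (le_lt_trans (probability_le1 m measurableT))// ltry.
exists G; split; first exact: num_real.
by move=> M GM x _ /=; rewrite (le_trans (hG _))// ltW.
Qed.

Lemma ae_preimage (P : set T) : {ae m, forall w, P w} ->
  {ae m, forall w, P (s w)}.
Proof.
move=> [A [mA A0 PA]]; exists (s @^-1` A); split => //.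
- by rewrite -[X in measurable X]setTI; exact: ms.
- by rewrite mp.
- by move=> w /= nP; apply: PA.
Qed.

Lemma ae_iter (P : set T) : {ae m, forall w, P w} ->
  {ae m, forall w, forall n, P (iter n s w)}.
Proof.
move=> aP; apply: ae_foralln => n.
elim: n P aP => [//|n IH] P aP.
exact: (IH (fun w => P (s w)) (ae_preimage aP)).
Qed.

Lemma Rintegral_preserving (h : T -> R) : measurable_fun setT h ->
  (forall w, 0 <= h w) -> \int[m]_w h (s w) = \int[m]_w h w.
Proof.
move=> mh h0; rewrite /Rintegral; congr fine.
have mEh : measurable_fun setT (EFin \o h) by exact/measurable_EFinP.
have hE0 : {in setT, forall y, (0 <= (EFin \o h) y)%E}.
  by move=> y _; rewrite /= lee_fin.
have := ge0_integral_pushforward ms m measurableT mEh hE0.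
rewrite preimage_setT => <-.
apply: eq_measure_integral => A mA _.
exact: mp.
Qed.

Definition birkhoff_sum (h : T -> R) n w := \sum_(j < n) h (iter j s w).

Lemma birkhoff_sumS (h : T -> R) n w :
  birkhoff_sum h n.+1 w = h w + birkhoff_sum h n (s w).
Proof.
rewrite /birkhoff_sum big_ord_recl; congr +%R.
by apply: eq_bigr => j _; rewrite lift0 iterSr.
Qed.

(** This is the maximum of the Birkhoff sums of lengths [0] to [L]. The recursion displays the shift
    by [s] on which Garsia's argument rests. *)
Fixpoint maximal_sum (h : T -> R) L w : R :=
  if L is L'.+1 then Num.max 0 (h w + maximal_sum h L' (s w)) else 0.

Lemma maximal_sum_ge0 (h : T -> R) L w : 0 <= maximal_sum h L w.
Proof. by case: L => //= L; rewrite le_max lexx. Qed.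

Lemma maximal_sum_nd h L w : maximal_sum h L w <= maximal_sum h L.+1 w.
Proof.
elim: L w => [|L IH] w; first exact: maximal_sum_ge0.
rewrite -/(maximal_sum h L.+2 w) [leLHS]/= [leRHS]/=.
by rewrite ge_max !le_max lexx /= lerD2l IH orbT.
Qed.

Lemma birkhoff_sum_le_maximal h n w : birkhoff_sum h n w <= maximal_sum h n w.
Proof.
elim: n w => [|n IH] w; first by rewrite /birkhoff_sum big_ord0.
by rewrite birkhoff_sumS /= le_max lerD2l IH orbT.
Qed.

Lemma measurable_maximal_sum h L : measurable_fun setT h ->
  measurable_fun setT (maximal_sum h L).
Proof.
move=> mh; elim: L => [|L IH] /=; first exact: measurable_cst.
apply: measurable_maxr; first exact: measurable_cst.
by apply: measurable_funD => //; exact: (measurableT_comp IH ms).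
Qed.

Lemma maximal_sum_le (h : T -> R) G L w : (forall w, `|h w| <= G) ->
  maximal_sum h L w <= L%:R * G.
Proof.
move=> hG; elim: L w => [|L IH] w /=; first by rewrite mul0r.
have G0 : 0 <= G by exact: le_trans (hG w).
rewrite ge_max mulr_ge0//= -natr1 mulrDl mul1r addrC lerD//.
by rewrite (le_trans _ (hG w))// ler_norm.
Qed.

Definition pos_maximal h L := [set w | 0 < maximal_sum h L w].

Lemma measurable_pos_maximal h L : measurable_fun setT h ->
  measurable (pos_maximal h L).
Proof.
move=> mh; rewrite -[pos_maximal _ _]setTI.
have -> : pos_maximal h L = maximal_sum h L @^-1` `]0, +oo[.
  by apply/seteqP; split=> w; rewrite /pos_maximal /= in_itv /= andbT.
exact: measurable_maximal_sum.
Qed.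

(* Garsia: [h + M_L o s >= M_L] on the set where [M_L > 0]. *)
Lemma maximal_ineq (h : T -> R) (G : R) L w : (forall w, `|h w| <= G) ->
  maximal_sum h L w - maximal_sum h L (s w) - G * (1 - \1_(pos_maximal h L) w)
    <= h w.
Proof.
move=> hG; have hw := hG w.
have M0 := maximal_sum_ge0 h L (s w).
rewrite indicE; case: (boolP (w \in _)) => [|].
  rewrite inE /pos_maximal => /= Mw; rewrite subrr mulr0 subr0.
  case: L M0 Mw => [|L] M0; first by rewrite /= ltxx.
  rewrite [maximal_sum _ _ w]/= => Mw.
  have := maximal_sum_nd h L (s w).
  move: Mw; rewrite lt_max ltxx /= => /ltW hM.
  by rewrite (max_idPr hM); lra.
rewrite notin_setE => /negP; rewrite -leNgt => Mw.
rewrite subr0 mulr1; move: hw; rewrite ler_norml => /andP[hw _].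
by lra.
Qed.

(** The coboundary [M_L - M_L o s] integrates to zero, so [maximal_ineq] leaves only the loss off
    the set where [M_L > 0]. If these sets fill the space as [L] grows, the mean of [h] is
    nonnegative. *)
Lemma Rintegral_maximal (h : T -> R) (G : R) L : measurable_fun setT h ->
  (forall w, `|h w| <= G) ->
  - (G * (1 - fine (m (pos_maximal h L)))) <= \int[m]_w h w.
Proof.
move=> mh hG.
have mM := @measurable_maximal_sum h L mh.
have mP := @measurable_pos_maximal h L mh.
have iM : m.-integrable setT (EFin \o maximal_sum h L).
  apply: (@bounded_measurable_integrable _ (L%:R * G)) => // w.
  by rewrite ger0_norm ?maximal_sum_ge0// maximal_sum_le.
have iMs : m.-integrable setT (EFin \o (fun w => maximal_sum h L (s w))).
  apply: (@bounded_measurable_integrable _ (L%:R * G)) => [|w].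
    exact: (measurableT_comp mM ms).
  by rewrite ger0_norm ?maximal_sum_ge0// maximal_sum_le.
have m1 : measurable_fun setT (fun w => 1 - \1_(pos_maximal h L) w : R).
  by apply: measurable_funB; [exact: measurable_cst|exact: measurable_indic].
have i1 : m.-integrable setT (EFin \o (fun w => 1 - \1_(pos_maximal h L) w : R)).
  apply: (@bounded_measurable_integrable _ 1) => // w.
  by rewrite indicE; case: (_ \in _); rewrite ?subrr ?normr0 ?ler01 ?subr0 ?normr1.
have i1G : m.-integrable setT (EFin \o (fun w => G * (1 - \1_(pos_maximal h L) w))).
  apply: (@bounded_measurable_integrable _ `|G|) => [|w]; first exact: measurable_funM.
  rewrite normrM ler_piMr//.
  by rewrite indicE; case: (_ \in _); rewrite ?subrr ?normr0 ?ler01 ?subr0 ?normr1.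
have iMMs : m.-integrable setT (EFin \o (fun w => maximal_sum h L w - maximal_sum h L (s w))).
  exact: (integrableB measurableT iM iMs).
have <- : \int[m]_w (maximal_sum h L w - maximal_sum h L (s w)
     - G * (1 - \1_(pos_maximal h L) w)) = - (G * (1 - fine (m (pos_maximal h L)))).
  rewrite RintegralB// RintegralB// Rintegral_preserving ?subrr ?sub0r//; last first.
    exact: maximal_sum_ge0.
  rewrite RintegralZl// RintegralB//; first last.
  - apply: (@bounded_measurable_integrable _ 1) => [|w]; first exact: measurable_indic.
    by rewrite indicE; case: (_ \in _); rewrite ?normr0 ?ler01 ?normr1.
  - by apply: (@bounded_measurable_integrable _ 1) => // w; rewrite normr1.
  congr (- (_ * (_ - _))).
    by rewrite Rintegral_cst// mul1r; exact: (congr1 fine (probability_setT m)).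
  by rewrite /Rintegral integral_indic// setIT.
apply: le_Rintegral => //.
- exact: (integrableB measurableT iMMs i1G).
- exact: (bounded_measurable_integrable mh hG).
- by move=> w _; exact: maximal_ineq.
Qed.

(** A one-sided substitute for the pointwise ergodic theorem. Where the sums are unbounded some
    [M_L] is positive, so a set of full measure of such points would contradict the negative mean
    through [Rintegral_maximal]. *)
Lemma birkhoff_sum_bounded (h : T -> R) G : ergodic m s ->
  measurable_fun setT h -> (forall w, `|h w| <= G) -> \int[m]_w h w < 0 ->
  {ae m, forall w, exists K, forall n, birkhoff_sum h n w <= K}.
Proof.
move=> erg mh hG hneg.
pose U := [set w | forall K : nat, exists n, K%:R < birkhoff_sum h n w].
have mS n : measurable_fun setT (birkhoff_sum h n).
  elim: n => [|n IH].
    have -> : birkhoff_sum h 0 = cst 0.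
      by apply/funext => w; rewrite /birkhoff_sum big_ord0.
    exact: measurable_cst.
  have -> : birkhoff_sum h n.+1 = (fun w => h w + birkhoff_sum h n (s w)).
    by apply/funext => w; exact: birkhoff_sumS.
  by apply: measurable_funD => //; exact: (measurableT_comp IH ms).
have mU : measurable U.
  have -> : U = \bigcap_K \bigcup_n (birkhoff_sum h n @^-1` `]K%:R, +oo[).
    apply/seteqP; split=> w.
      move=> Uw K _; have [n hn] := Uw K; exists n => //=.
      by rewrite in_itv /= andbT.
    move=> Uw K; have [n _] := Uw K I; rewrite /= in_itv /= andbT => hn.
    by exists n.
  apply: bigcap_measurable => // K _; apply: bigcup_measurable => n _.
  by rewrite -[X in measurable X]setTI; exact: mS.
(* A step along the orbit changes a Birkhoff sum by at most [G], so unboundedness passes both ways;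
   [ergodic] asks for exact invariance. *)
have invU : s @^-1` U = U.
  apply/seteqP; split=> w /= Uw K.
    have [k hk] : exists k : nat, K%:R + G <= k%:R.
      exists (Num.truncn (K%:R + G)).+1; apply/ltW.
      by rewrite truncnS_gt.
    have [n hn] := Uw k; exists n.+1; rewrite birkhoff_sumS.
    move: (hG w); rewrite ler_norml => /andP[h1 h2]; lra.
  have [k hk] : exists k : nat, K%:R + G <= k%:R.
    exists (Num.truncn (K%:R + G)).+1; apply/ltW.
    by rewrite truncnS_gt.
  have [[|n]] := Uw k.
    rewrite /birkhoff_sum big_ord0 => k0.
    by have := ler0n R k; rewrite leNgt k0.
  rewrite birkhoff_sumS => hn; exists n.
  move: (hG w); rewrite ler_norml => /andP[h1 h2]; lra.
have [U0|U1] := erg _ mU invU.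
  exists U; split => // w /=; apply: contra_notP => nU.
  have [K hK] : exists K : nat, forall n, birkhoff_sum h n w <= K%:R.
    apply/not_existsP => nK; apply: nU => K.
    have /existsNP[n] := nK K.
    by move/negP; rewrite -ltNge; exists n.
  by exists K%:R.
exfalso; move: hneg; apply/negP; rewrite -leNgt.
have UE : U `<=` \bigcup_L pos_maximal h L.
  move=> w Uw; have [n hn] := Uw 0%N; exists n => //=.
  by rewrite /pos_maximal /= (lt_le_trans hn)// birkhoff_sum_le_maximal.
have mE : measurable (\bigcup_L pos_maximal h L).
  by apply: bigcup_measurable => L _; exact: measurable_pos_maximal.
have E1 : m (\bigcup_L pos_maximal h L) = 1%E.
  apply/eqP; rewrite eq_le probability_le1//= -U1.
  by rewrite le_measure// inE.
have ndE : nondecreasing_seq (pos_maximal h).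
  apply/nondecreasing_seqP => L; apply/subsetPset => w.
  rewrite /pos_maximal /= => /lt_le_trans; apply; exact: maximal_sum_nd.
have cE : (m \o pos_maximal h) L @[L --> \oo] --> 1%:E.
  rewrite -E1; apply: nondecreasing_cvg_mu => // L.
  exact: measurable_pos_maximal.
have cE' : fine (m (pos_maximal h L)) @[L --> \oo] --> (1 : R).
  exact: (fine_cvg cE).
have cL : - (G * (1 - fine (m (pos_maximal h L)))) @[L --> \oo] --> (0 : R).
  rewrite -oppr0 -(mulr0 G) -[X in G * X](subrr 1).
  apply: cvgN; apply: cvgMr; apply: cvgB => //; exact: cvg_cst.
rewrite -(cvg_lim _ cL)//; apply: limr_le.
  by apply/cvg_ex; exists 0.
by near=> L; exact: Rintegral_maximal.
Unshelve. all: by end_near. Qed.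

End MeasurePreserving.

(** * Maker's ergodic theorem *)

Section NonmeasurableIntegral.
Local Open Scope ereal_scope.
Context (d : measure_display) (T : measurableType d) (R : realType)
  (m : {measure set T -> \bar R}).

Lemma ge0_le_integral_nonmeasurable (f g : T -> \bar R) :
  (forall x, 0 <= f x) -> (forall x, f x <= g x) ->
  \int[m]_x f x <= \int[m]_x g x.
Proof.
move=> f0 fg; rewrite !ge0_integralTE//; last first.
  by move=> x; exact: le_trans (f0 x) (fg x).
apply: le_ereal_sup => _ [h hf <-]; exists h => // x.
exact: le_trans (hf x) (fg x).
Qed.

(** As [m] need not be complete, [f] may fail to be measurable. It is squeezed between two
    measurable modifications of [g], by [0] and by [+oo] on the exceptional null set. *)
Lemma ge0_ae_eq_integral_nonmeasurable (f g : T -> \bar R) :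
  measurable_fun setT g -> (forall x, 0 <= f x) -> (forall x, 0 <= g x) ->
  {ae m, forall x, f x = g x} -> \int[m]_x f x = \int[m]_x g x.
Proof.
move=> mg f0 g0 [A [mA A0 fgA]].
have fgE x : ~ A x -> f x = g x.
  by move=> nA; apply: contrapT => nfg; apply: nA; exact: fgA.
pose gl := g \_ (~` A); pose gu x := if x \in A then +oo else g x.
have mgl : measurable_fun setT gl.
  apply/measurable_restrict => //; first exact: measurableC.
  by rewrite setTI; exact: measurable_funS mg.
have mgu : measurable_fun setT gu.
  apply: measurable_fun_ifT => //.
  by apply: (measurable_fun_bool true); rewrite setTI preimage_mem_true.
have aegl : {ae m, forall x, setT x -> gl x = g x}.
  exists A; split => // x /= /not_implyP[_]; apply: contra_notP => nA.
  by rewrite /gl patchE mem_set.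
have aegu : {ae m, forall x, setT x -> gu x = g x}.
  exists A; split => // x /= /not_implyP[_]; apply: contra_notP => nA.
  by rewrite /gu memNset.
have glf x : gl x <= f x.
  rewrite /gl patchE; case: ifPn => [|_]; last exact: f0.
  by rewrite in_setC => /negP xA; rewrite fgE// => Ax; apply: xA; rewrite inE.
have fgu x : f x <= gu x.
  rewrite /gu; case: ifPn => [_|/negP xA]; first exact: leey.
  by rewrite fgE// => Ax; apply: xA; rewrite inE.
have gl0 x : 0 <= gl x by rewrite /gl patchE; case: ifP.
have gu0 x : 0 <= gu x by rewrite /gu; case: ifP.
apply/eqP; rewrite eq_le; apply/andP; split.
  rewrite -(ge0_ae_eq_integral _ _ _ _ _ aegu)//.
  exact: ge0_le_integral_nonmeasurable.
rewrite -(ge0_ae_eq_integral _ _ _ _ _ aegl)//.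
exact: ge0_le_integral_nonmeasurable.
Qed.

Lemma ae_eq_integral_nonmeasurable (f g : T -> \bar R) :
  measurable_fun setT g -> {ae m, forall x, f x = g x} ->
  \int[m]_x f x = \int[m]_x g x.
Proof.
move=> mg fg; rewrite integralE [RHS]integralE; congr (_ - _).
- apply: ge0_ae_eq_integral_nonmeasurable => //; first exact: measurable_funepos.
  by apply: filterS fg => x; rewrite !funeposE => ->.
- apply: ge0_ae_eq_integral_nonmeasurable => //; first exact: measurable_funeneg.
  by apply: filterS fg => x; rewrite !funenegE => ->.
Qed.

End NonmeasurableIntegral.

Section Maker.
Context (R : realType) (d : measure_display) (T : measurableType d)
  (m : probability T R) (s : T -> T) (ms : measurable_fun setT s)
  (mp : forall A, measurable A -> m (s @^-1` A) = m A) (erg : ergodic m s).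

(** The tail supremum [p M] dominates all later [g N], so one fixed function replaces the changing
    ones; dominated convergence brings its integral close to that of [l]. *)
Lemma maker_upper (g : nat -> T -> R) (l : T -> R) (G e : R) :
  (forall n, measurable_fun setT (g n)) -> measurable_fun setT l ->
  (forall n w, `|g n w| <= G) -> 0 < e ->
  {ae m, forall w, g ^~ w @ \oo --> l w} ->
  {ae m, forall w, \forall N \near \oo,
    birkhoff_sum s (g N) N w <= N%:R * (\int[m]_w l w + e)}.
Proof.
move=> mg ml gG e0 gl.
pose p M w := sups (g ^~ w) M.
have ubg w : has_ubound (range (g ^~ w)).
  by exists G => _ [n _ <-]; exact: le_trans (ler_norm _) (gG _ _).
have mp' M : measurable_fun setT (p M) by exact: measurable_fun_sups.
have gp n M w : (M <= n)%N -> g n w <= p M w.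
  move=> Mn; apply: ub_le_sup; last by exists n.
  by exists G => _ [k _ <-]; exact: le_trans (ler_norm _) (gG _ _).
have pG M w : `|p M w| <= G.
  rewrite ler_norml; apply/andP; split.
    rewrite (le_trans _ (gp M M w (leqnn _)))//.
    by have := gG M w; rewrite ler_norml => /andP[].
  apply: ge_sup; first by exists (g M w); exists M => //=.
  by move=> _ [k _ <-]; exact: le_trans (ler_norm _) (gG _ _).
have iG : m.-integrable setT (EFin \o (cst G)).
  exact: (@bounded_measurable_integrable _ _ _ m _ `|G|).
have pl : {ae m, forall w, setT w -> (EFin \o p ^~ w) @ \oo --> (EFin \o l) w}.
  by apply: filterS gl => w /= gw _; apply: cvg_EFin; [near=> n|exact: cvg_sups gw].
have mpE n : measurable_fun setT (EFin \o p n) by exact/measurable_EFinP.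
have mlE : measurable_fun setT (EFin \o l) by exact/measurable_EFinP.
have pGe : {ae m, forall w (n : nat), setT w -> (`|(EFin \o p n) w| <= (EFin \o cst G) w)%E}.
  by apply: aeW => w n _ /=; rewrite lee_fin.
have [il _ cpl] := dominated_convergence measurableT mpE mlE pl iG pGe.
have {}cpl : (\int[m]_w p n w) @[n --> \oo] --> \int[m]_w l w.
  apply: fine_cvg; rewrite fineK//; exact: integrable_fin_num il.
have [M hM] : exists M, \int[m]_w p M w < \int[m]_w l w + e / 2.
  near \oo => M; exists M; near: M.
  by apply: (cvgr_lt _ cpl); rewrite ltrDl divr_gt0.
(* [c] lies above the mean of [p M] and [e / 2] below the target: the sums of [p M - c] stay below
   some [K], which [N * (e / 2)] absorbs for large [N]. *)
pose c := \int[m]_w l w + e / 2.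
have mh : measurable_fun setT (fun w => p M w - c).
  by apply: measurable_funB => //; exact: measurable_cst.
have hh w : `|p M w - c| <= G + `|c| by rewrite (le_trans (ler_normB _ _))// lerD2r.
have hneg : \int[m]_w (p M w - c) < 0.
  rewrite RintegralB//; first last.
  - by apply: (@bounded_measurable_integrable _ _ _ m _ `|c|).
  - exact: (bounded_measurable_integrable m (mp' M) (pG M)).
  rewrite subr_lt0; apply: (lt_le_trans hM).
  by rewrite Rintegral_cst// (congr1 fine (probability_setT m)) mulr1.
have := birkhoff_sum_bounded ms mp erg mh hh hneg.
apply: filterS => w [K hK].
near=> N.
have : birkhoff_sum s (g N) N w <= birkhoff_sum s (fun w => p M w - c) N w + N%:R * c.
  rewrite /birkhoff_sum sumrB sumr_const card_ord -(mulr_natl c) subrK.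
  by apply: ler_sum => j _; apply: gp; near: N; exact: nbhs_infty_ge.
move/le_trans; apply; rewrite -lerBrDr -mulrBr (le_trans (hK N))//.
have -> : \int[m]_w l w + e - c = e / 2 by rewrite /c; lra.
rewrite -ler_pdivrMr ?divr_gt0//.
near: N; exact: nbhs_infty_ger.
Unshelve. all: by end_near. Qed.

Lemma maker_bounded (g : nat -> T -> R) (l : T -> R) (G : R) :
  (forall n, measurable_fun setT (g n)) -> measurable_fun setT l ->
  (forall n w, `|g n w| <= G) -> (forall w, `|l w| <= G) ->
  {ae m, forall w, g ^~ w @ \oo --> l w} ->
  {ae m, forall w,
    (birkhoff_sum s (g N) N w / N%:R) @[N --> \oo] --> \int[m]_w l w}.
Proof.
move=> mg ml gG lG gl.
have upper : {ae m, forall w, forall k : nat, \forall N \near \oo,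
    birkhoff_sum s (g N) N w <= N%:R * (\int[m]_w l w + k.+1%:R^-1)}.
  by apply: ae_foralln => k; apply: (@maker_upper _ _ G).
have lower : {ae m, forall w, forall k : nat, \forall N \near \oo,
    birkhoff_sum s (fun w => - g N w) N w <= N%:R * (\int[m]_w (- l w) + k.+1%:R^-1)}.
  apply: ae_foralln => k; apply: (@maker_upper (fun n w => - g n w) _ G) => //.
  - by move=> n; exact: measurableT_comp.
  - exact: measurableT_comp.
  - by move=> n w; rewrite normrN.
  - by apply: filterS gl => w; exact: cvgN.
have lN : \int[m]_w (- l w) = - \int[m]_w l w.
  under eq_Rintegral do rewrite -mulN1r.
  by rewrite RintegralZl ?mulN1r//; exact: (bounded_measurable_integrable m ml lG).
apply: filterS2 upper lower => w up lo.
apply/cvgrPdist_le => e e0.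
pose k := Num.truncn (e^-1).
have ke : k.+1%:R^-1 <= e.
  by rewrite invf_ple ?posrE// ltW// truncnS_gt.
near=> N.
have N0 : 0 < N%:R :> R by rewrite ltr0n; near: N; exact: nbhs_infty_gt.
have h1 : birkhoff_sum s (g N) N w <= N%:R * (\int[m]_w l w + k.+1%:R^-1).
  by near: N; exact: up.
have h2 : birkhoff_sum s (fun w => - g N w) N w <= N%:R * (\int[m]_w (- l w) + k.+1%:R^-1).
  by near: N; exact: lo.
rewrite /birkhoff_sum sumrN lN -/(birkhoff_sum s (g N) N w) in h2.
rewrite distrC ler_norml; apply/andP; split.
  rewrite lerBrDr ler_pdivlMr// mulrC; move: h2.
  rewrite lerNl -mulrN opprD opprK => /(le_trans _); apply.
  by rewrite ler_pM2l// addrC lerD2l lerN2.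
rewrite lerBlDr ler_pdivrMr// mulrC (le_trans h1)// ler_pM2l//.
by rewrite addrC lerD2r.
Unshelve. all: by end_near. Qed.

(** Truncation makes the bound hold everywhere and, off a null set, leaves [g n] unchanged from [N0]
    on; [limn_sup] then supplies a measurable version of [l]. *)
Lemma maker (g : nat -> T -> R) (l : T -> R) (G : R) (N0 : nat) :
  (forall n, measurable_fun setT (g n)) ->
  {ae m, forall w, forall n, (N0 <= n)%N -> `|g n w| <= G} ->
  {ae m, forall w, g ^~ w @ \oo --> l w} ->
  {ae m, forall w,
    (birkhoff_sum s (g N) N w / N%:R) @[N --> \oo] --> \int[m]_w l w}.
Proof.
move=> mg gG gl.
pose cut (x : R) := Num.max (- `|G|) (Num.min `|G| x).
have cutE x : `|x| <= G -> cut x = x.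
  move=> /le_trans/(_ (ler_norm G)); rewrite ler_norml => /andP[h1 h2].
  by rewrite /cut (min_idPr h2) (max_idPr h1).
have cut_le x : `|cut x| <= `|G|.
  rewrite /cut ler_norml le_max lexx /= ge_max ge_min lexx /= andbT.
  by rewrite (@le_trans _ _ 0)// oppr_le0.
have mcut (f : T -> R) : measurable_fun setT f -> measurable_fun setT (cut \o f).
  move=> mf; have -> : cut \o f = cst (- `|G|) \max (cst `|G| \min f) by [].
  by apply: measurable_maxr => //; exact: measurable_minr.
pose g' n := cut \o g n.
pose l' w := limn_sup (g' ^~ w).
have mg' n : measurable_fun setT (g' n) by exact: mcut.
have ml' : measurable_fun setT l'.
  apply: measurable_fun_limn_sup => // w _.
    exists `|G| => _ [n _ <-]; exact: le_trans (ler_norm _) (cut_le _).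
  exists (- `|G|) => _ [n _ <-].
  by have := cut_le (g n w); rewrite ler_norml => /andP[].
have gl' : {ae m, forall w, g' ^~ w @ \oo --> l w /\ cut (l' w) = l w}.
  apply: filterS2 gG gl => w gGw glw.
  have g'l : g' ^~ w @ \oo --> l w.
    apply: cvg_trans glw; apply: near_eq_cvg; near=> n.
    by rewrite /g' /= cutE// gGw//; near: n; exact: nbhs_infty_ge.
  split => //; rewrite /l' /limn_sup (cvg_lim _ (cvg_sups g'l))// cutE//.
  rewrite -(cvg_lim _ (cvg_norm glw))//; apply: limr_le.
    by apply/cvg_ex; exists `|l w|; exact: cvg_norm.
  by near=> n; apply: gGw; near: n; exact: nbhs_infty_ge.
have -> : \int[m]_w l w = \int[m]_w cut (l' w).
  congr fine; apply: ae_eq_integral_nonmeasurable.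
    by apply/measurable_EFinP; exact: mcut.
  by apply: filterS gl' => w [_ ->].
have hg' : {ae m, forall w, (birkhoff_sum s (g' N) N w / N%:R) @[N --> \oo] -->
    \int[m]_w cut (l' w)}.
  apply: (@maker_bounded _ _ `|G|) => //.
  - exact: mcut.
  - by move=> n w; exact: cut_le.
  - by apply: filterS gl' => w [h ->].
(* The truncation must be invisible at all points of the orbit, not only at [w]. *)
apply: filterS2 (ae_iter ms mp gG) hg' => w gGw hw.
apply: cvg_trans hw; apply: near_eq_cvg; near=> N.
congr (_ / _); apply: eq_bigr => j _; rewrite /g' /= cutE// gGw//.
near: N; exact: nbhs_infty_ge.
Unshelve. all: by end_near. Qed.

End Maker.

(** * Products of factors close to one *)

Lemma expR_lower (R : realType) (x : R) : 0 <= x <= 2^-1 ->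
  expR (- x - 2 * x ^+ 2) <= 1 - x.
Proof.
move=> /andP[x0 x2].
rewrite (_ : - x - 2 * x ^+ 2 = - (x + 2 * x ^+ 2)); last by ring.
rewrite expRN -[leLHS]mul1r ler_pdivrMr ?expR_gt0//.
(* With [y = x + 2 x^2], the bound [1 + y <= expR y] reduces the claim to [1 <= (1 - x) (1 + y)].
   The excess is [x^2 (1 - 2 x)], nonnegative for [x <= 1/2]. *)
have h := expR_ge1Dx (x + 2 * x ^+ 2).
apply: (@le_trans _ _ ((1 - x) * (1 + (x + 2 * x ^+ 2)))); last first.
  by rewrite ler_wpM2l//; lra.
have -> : (1 - x) * (1 + (x + 2 * x ^+ 2)) = 1 + x ^+ 2 * (1 - 2 * x) by ring.
by rewrite lerDl mulr_ge0 ?sqr_ge0//; lra.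
Qed.

Lemma cvg_invn (R : realType) : (N%:R^-1 : R) @[N --> \oo] --> (0 : R).
Proof.
apply/cvgr0Pnorm_le => e e0; near=> N.
have N0 : 0 < N%:R :> R by rewrite ltr0n; near: N; exact: nbhs_infty_gt.
rewrite ger0_norm ?invr_ge0// invf_ple ?posrE//.
near: N; exact: nbhs_infty_ger.
Unshelve. all: by end_near. Qed.

(* If the factors are [1 - O(1/N)], only their first-order terms survive. *)
Lemma prod_cvg_expR (R : realType) (x : nat -> nat -> R) (G s : R) :
  (\forall N \near \oo, forall j, 0 <= x N j <= G / N%:R) ->
  \sum_(j < N) x N j @[N --> \oo] --> s ->
  \prod_(j < N) (1 - x N j) @[N --> \oo] --> expR (- s).
Proof.
move=> xG xs.
have cS : expR (- \sum_(j < N) x N j) @[N --> \oo] --> expR (- s).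
  by apply: continuous_cvg; [exact: continuous_expR|exact: (cvgN xs)].
(* The [N] quadratic errors of [expR_lower] are at most [2 (G / N)^2] each, hence [2 G^2 / N] in
   total. *)
have cL : expR (- \sum_(j < N) x N j - 2 * G ^+ 2 * N%:R^-1) @[N --> \oo] --> expR (- s).
  apply: continuous_cvg; first exact: continuous_expR.
  rewrite (_ : - s = - s - 2 * G ^+ 2 * 0); last by rewrite mulr0 subr0.
  apply: cvgB; first exact: (cvgN xs).
  by apply: cvgMr; exact: cvg_invn.
apply: squeeze_cvgr cL cS; near=> N.
have xN : forall j, 0 <= x N j <= G / N%:R by near: N; exact: xG.
have N0 : (0 < N)%N by near: N; exact: nbhs_infty_gt.
have N0' : 0 < N%:R :> R by rewrite ltr0n.
have GN : G / N%:R <= 2^-1.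
  rewrite ler_pdivrMr// mulrC -ler_pdivrMr// invrK.
  by near: N; exact: nbhs_infty_ger.
have x2 j : 0 <= x N j <= 2^-1.
  by have /andP[-> /le_trans ->] := xN j.
have EN : expR (- \sum_(j < N) x N j) = \prod_(j < N) expR (- x N j).
  by rewrite -sumrN expR_sum.
apply/andP; split; last first.
  rewrite EN; apply: ler_prod => j _; have /andP[x0 x1] := x2 j.
  by rewrite expR_ge1Dx andbT; lra.
apply: (@le_trans _ _ (\prod_(j < N) expR (- x N j - 2 * x N j ^+ 2))); last first.
  by apply: ler_prod => j _; rewrite expR_ge0 expR_lower.
rewrite -expR_sum ler_expR sumrB sumrN lerD2l lerN2.
apply: (@le_trans _ _ (\sum_(j < N) 2 * (G / N%:R) ^+ 2)).
  apply: ler_sum => j _; have /andP[x0 x1] := xN j.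
  by rewrite ler_pM2l// ler_sqr ?nnegrE// (le_trans x0).
rewrite sumr_const card_ord -mulr_natl -subr_ge0 -[X in 0 <= X](_ : 0 = _)//.
by field; rewrite gt_eqF.
Unshelve. all: by end_near. Qed.

(** * Open transfer operators *)

Lemma eq_tsum (R : realType) (I : choiceType) (D : set I) (a b : I -> R) :
  (forall i, D i -> a i = b i) -> tsum D a = tsum D b.
Proof.
by move=> ab; rewrite /tsum; congr (fine _ - fine _); apply: eq_esum => i /ab ->.
Qed.

Lemma tsum_eq0 (R : realType) (I : choiceType) (D : set I) (a : I -> R) :
  (forall i, D i -> a i = 0) -> tsum D a = 0.
Proof.
move=> a0; rewrite /tsum !esum1 ?subrr// => i /a0 ->; by rewrite ?oppr0 maxxx.
Qed.

Lemma Rintegral_indic_le d (T : measurableType d) (R : realType)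
    (nu : {measure set T -> \bar R}) (f : T -> R) (A : set T) (c : R) :
  (nu setT < +oo)%E -> (0 < nu setT)%E ->
  measurable_fun setT f -> measurable A -> (Lnorm nu +oo (EFin \o f) <= c%:E)%E ->
  `|\int[nu]_x (f x * \1_A x)| <= c * fine (nu A).
Proof.
move=> nuoo nu0 mf mA; move=> fc.
have c0 : (0 <= c%:E)%E by apply: le_trans fc; exact: Lnorm_ge0.
move: fc; rewrite unlock nu0 => /ess_supP fc.
have nuA : nu A \is a fin_num.
  rewrite ge0_fin_numE//; apply: le_lt_trans nuoo.
  by apply: le_measure; rewrite ?inE.
have mfA : measurable_fun A (EFin \o f).
  by apply/measurable_EFinP; exact: measurable_funS mf.
have -> : \int[nu]_x (f x * \1_A x) = \int[nu]_(x in A) f x.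
  rewrite [RHS]Rintegral_mkcond; apply: eq_Rintegral => x _.
  by rewrite patchE indicE; case: (_ \in _); rewrite ?mulr1 ?mulr0.
have h : (\int[nu]_(x in A) `|(f x)%:E| <= c%:E * nu A)%E.
  apply: integral_le_bound => //.
  by apply: filterS fc => x /= hx _.
have h2 : (`|\int[nu]_(x in A) (f x)%:E| <= c%:E * nu A)%E.
  exact: le_trans (le_abse_integral _ _ mfA) h.
have cA : (c%:E * nu A)%E \is a fin_num by rewrite fin_numM.
have -> : c * fine (nu A) = fine (c%:E * nu A) by rewrite fineM.
rewrite /Rintegral -fine_abse; last first.
  rewrite -abse_fin_num ge0_fin_numE//; apply: le_lt_trans h2 _.
  by rewrite ltey_eq cA.
apply: fine_le => //.
rewrite ge0_fin_numE//; apply: le_lt_trans h2 _.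
by rewrite ltey_eq cA.
Qed.

Section OpenSystem.
Context (R : realType) (d : measure_display) (Omega : measurableType d)
  (m : probability Omega R) (X : completePseudoMetricType R)
  (S : open_data Omega X).

Local Notation sg := (sigma S).
Local Notation sgV := (sigmaV S).

(** Here [n] counts the times at which the hole is avoided, whereas in [surv] it is the last such
    time. The unconstrained case [n = 0] starts the inductions. *)
Definition survp (w : Omega) (n N : nat) : set X :=
  [set x | J S w x /\
    forall j, (j < n)%N -> ~ hole S (iter j sg w) N (Titer S j w x)].

Lemma survpS w n N : survp w n.+1 N = surv S w n N.
Proof. by []. Qed.

Lemma survp0 w N : survp w 0 N = J S w.
Proof. by apply/seteqP; split=> x //; case. Qed.

Lemma TiterSr n w x : Titer S n.+1 w x = Titer S n (sg w) (Tmap S w x).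
Proof. by elim: n => //= n IH; rewrite -IH -iterS iterSr. Qed.

Lemma survp_nonincr w n k N : (n <= k)%N -> survp w k N `<=` survp w n N.
Proof.
by move=> nk x [Jx h]; split => // j jn; apply: h; exact: leq_trans nk.
Qed.

Lemma survp1D w N : J S w `\` survp w 1 N = hole S w N.
Proof.
apply/seteqP; split=> [x [Jx]|x Hx].
  by apply: contra_notP => nH; split => // -[].
have [_ Jx _] := Hx; split => // -[_ /(_ 0%N)]; exact.
Qed.

Section Fibrewise.
Hypothesis hS : random_open_system m S.

Lemma survp_rec w n N : survp w n.+1 N =
  [set x | (J S w `\` hole S w N) x /\ survp (sg w) n N (Tmap S w x)].
Proof.
apply/seteqP; split=> x.
  move=> [Jx h]; split.
    by split => //; exact: (h 0%N).
  split; first exact: (T_maps (ros_base hS)).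
  by move=> j jn; rewrite -TiterSr -iterSr; exact: h.
move=> [[Jx nH] [_ h]]; split => // -[_|j] //.
by rewrite ltnS => /h; rewrite -TiterSr -iterSr.
Qed.

(** On the fibre over [x], survival after the first step depends on [x] alone, so its indicator
    leaves the sum; the condition at time zero is the one built into [open_transfer]. *)
Lemma transfer_survp w n N (f : X -> R) x :
  transfer S w (fun y => f y * \1_(survp w n.+1 N) y) x =
  \1_(survp (sg w) n N) x * open_transfer S w N f x.
Proof.
rewrite /open_transfer /transfer indicE.
case: (boolP (x \in _)) => [|]; rewrite ?inE => hx.
  rewrite mul1r; apply: eq_tsum => y [Jy Ty]; congr (_ * _ * _).
  rewrite !indicE; congr (_ %:R); congr nat_of_bool.
  by apply/idP/idP; rewrite !inE survp_rec /= Ty => //; case.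
rewrite mul0r; apply: tsum_eq0 => y [Jy Ty].
rewrite indicE memNset ?mulr0 ?mul0r// survp_rec /= Ty => -[_ hx'].
by move: hx; rewrite notin_setE.
Qed.

Lemma open_transfer_out w N (f : X -> R) x :
  ~ J S (sg w) x -> open_transfer S w N f x = 0.
Proof.
move=> nJ; apply: tsum_eq0 => y [Jy Ty].
by case: nJ; rewrite -Ty; exact: (T_maps (ros_base hS)).
Qed.

Lemma measurable_J w : @measurable _ (Borel X) (J S w).
Proof.
rewrite -[J S w]setCK; apply: measurableC; apply: sub_sigma_algebra.
by apply: closed_openC; exact: (J_closed (ros_base hS)).
Qed.

(** [J0] is not known to be measurable, but its sections are closed, so the sections of
    trace-measurable sets are Borel. *)
Lemma measurable_section (Y : set (Omega * Borel X)) w :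
  strace measurable (J0 S) Y -> @measurable _ (Borel X) [set x | Y (w, x)].
Proof.
move=> [Z mZ <-].
have -> : [set x | (Z `&` J0 S) (w, x)] = xsection Z w `&` J S w.
  by apply/seteqP; split=> x /=; rewrite /xsection /= inE.
by apply: measurableI; [exact: measurable_xsection|exact: measurable_J].
Qed.

Lemma measurable_hole w N : @measurable _ (Borel X) (hole S w N).
Proof. exact: (measurable_section w (ros_hole_meas hS N)). Qed.

Lemma measurable_Tpreimage w A : @measurable _ (Borel X) A ->
  @measurable _ (Borel X) (J S w `&` Tmap S w @^-1` A).
Proof.
move=> mA.
have mY : measurable ([set: Omega] `*` (A : set (Borel X))).
  by apply: measurableX.
have := measurable_section w (ros_M1 hS mY).
set A1 := [set x | _]; suff -> : A1 = J S w `&` Tmap S w @^-1` A by [].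
apply/seteqP; split=> x; first by move=> [Jx [_ Tx]].
by move=> [Jx Tx].
Qed.

Lemma measurable_survp w n N : @measurable _ (Borel X) (survp w n N).
Proof.
elim: n w => [|n IH] w; first by rewrite survp0; exact: measurable_J.
have -> : survp w n.+1 N =
    (J S w `&` Tmap S w @^-1` (survp (sg w) n N)) `\` hole S w N.
  rewrite survp_rec; apply/seteqP; split=> x /=.
    by move=> [[Jx nH] h].
  by move=> [[Jx h] nH].
apply: measurableD; last exact: measurable_hole.
by apply: measurable_Tpreimage; exact: IH.
Qed.

Lemma nu0_fin w : (nu S 0 w setT < +oo)%E.
Proof. by rewrite (nu0_prob (ros_CCM hS)) ltry. Qed.

Lemma nu0_gt0 w : (0 < nu S 0 w setT)%E.
Proof. by rewrite (nu0_prob (ros_CCM hS)) lte01. Qed.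

Section Integrals.
Hypothesis hC2 : cond_C2 m S.

Lemma integrable_ev N w (f : B S w) : (nu S N w).-integrable setT (EFin \o ev S f).
Proof. by have [_ []] := hC2 N; move=> h _; exact: h. Qed.

Lemma measurable_ev w (f : B S w) : measurable_fun setT (ev S f : Borel X -> R).
Proof. by apply/measurable_EFinP; exact: measurable_int (integrable_ev 0 f). Qed.

Lemma measurable_ev_indic w (f : B S w) (A : set X) : @measurable _ (Borel X) A ->
  measurable_fun setT (fun x : Borel X => ev S f x * \1_A x).
Proof.
by move=> mA; apply: measurable_funM; [exact: measurable_ev|exact: measurable_indic].
Qed.

Lemma integrable_ev_indic N w (f : B S w) (A : set X) : @measurable _ (Borel X) A ->
  (nu S N w).-integrable setT (EFin \o (fun x : Borel X => ev S f x * \1_A x)).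
Proof.
move=> mA; apply: le_integrable (integrable_ev N f) => //.
  by apply/measurable_EFinP; exact: measurable_ev_indic.
move=> x _ /=; rewrite lee_fin normrM ler_piMr// indicE.
by case: (_ \in _); rewrite ?normr1 ?normr0 ?ler01.
Qed.

Lemma Rintegral_ev_indicD w (f : B S w) (A A' : set X) :
  @measurable _ (Borel X) A -> @measurable _ (Borel X) A' -> A' `<=` A ->
  \int[nu S 0 w]_x (ev S f x * \1_(A `\` A') x) =
  \int[nu S 0 w]_x (ev S f x * \1_A x) - \int[nu S 0 w]_x (ev S f x * \1_A' x).
Proof.
move=> mA mA' sA; rewrite -RintegralB//; try exact: integrable_ev_indic.
apply: eq_Rintegral => x _; rewrite -mulrBr; congr (_ * _).
rewrite !indicE in_setD; case: (boolP (x \in A')) => /= xA'.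
  rewrite andbF; suff -> : x \in A by rewrite subrr.
  by move: xA'; rewrite !inE; exact: sA.
by rewrite andbT subr0.
Qed.

Lemma ev_J w (f : B S w) x : ev S f x * \1_(J S w) x = ev S f x.
Proof.
rewrite indicE; case: (boolP (x \in _)); rewrite ?mulr1// notin_setE => nJ.
by rewrite mulr0 (ev_out (ros_spaces hS)).
Qed.

Lemma Rintegral_ev_bound w (g : B S w) (A : set X) (c : R) :
  @measurable _ (Borel X) A -> (Linfty_norm S w (ev S g) <= c%:E)%E ->
  `|\int[nu S 0 w]_x (ev S g x * \1_A x)| <= c * fine (nu S 0 w A).
Proof.
move=> mA gc; apply: Rintegral_indic_le => //.
- exact: nu0_fin.
- exact: nu0_gt0.
- exact: measurable_ev.
Qed.

Variable Q : nat -> forall w, {linear B S w -> B S (sg w)}.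
Hypothesis hC3 : cond_C3 m Q.

(** Gathers the almost sure identities at one base point, so that what follows concerns a single
    orbit without exceptional sets. *)
Definition regular (w : Omega) : Prop :=
  [/\ forall (f : B S w) n N,
    \int[nu S 0 (sg w)]_x transfer S w (fun y => ev S f y * \1_(surv S w n N) y) x =
      lam S 0 w * \int[nu S 0 w]_x (ev S f x * \1_(surv S w n N) x),
   forall N, \int[nu S 0 w]_x ev S (phi S N w) x = 1 &
   forall N,
  (forall (f : B S w) x, J S (sg w) x ->
    (lam S N w)^-1 * open_transfer S w N (ev S f) x =
      (\int[nu S N w]_y ev S f y) * ev S (phi S N (sg w)) x
      + ev S (Q N w f) x) /\
  Q N w (phi S N w) = 0 /\
  (forall f : B S w, \int[nu S N (sg w)]_x ev S (Q N w f) x = 0)].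

Lemma regular_ae : {ae m, forall w, regular w}.
Proof.
have h1 : {ae m, forall w, forall N, \int[nu S 0 w]_x ev S (phi S N w) x = 1}.
  by apply: ae_foralln => N; have [_ [_ [_ [_ [_ [_ []]]]]]] := hC2 N.
have h2 := ae_foralln hC3.
by apply: filterS3 (ros_conformal_surv hS) h1 h2 => w; split.
Qed.

Lemma lam_gt0 N w : 0 < lam S N w.
Proof. by have [_ [_ [[_ h _] _]]] := hC2 N; exact: h. Qed.

Lemma conformal_open w N k (f : B S w) : regular w ->
  \int[nu S 0 (sg w)]_x (\1_(survp (sg w) k N) x * open_transfer S w N (ev S f) x) =
  lam S 0 w * \int[nu S 0 w]_x (ev S f x * \1_(survp w k.+1 N) x).
Proof.
move=> [h _ _]; rewrite survpS -h; apply: eq_Rintegral => x _.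
by rewrite -transfer_survp.
Qed.

(** Along regular orbits this is [L_eps^n f] divided by [lamn n w N]. It is built from the right
    side of [cond_C3] because an element of the Banach fibre is wanted, whereas [open_transfer]
    yields a mere function. *)
Fixpoint normalized_iter N n w (f : B S w) : B S (iter n sg w) :=
  if n is n'.+1 then
    (\int[nu S N (iter n' sg w)]_x ev S (normalized_iter N n' f) x)
      *: phi S N (iter n'.+1 sg w) + Q N (iter n' sg w) (normalized_iter N n' f)
  else f.

Section Orbit.
Variables (w : Omega) (N : nat).
Hypothesis Hreg : forall n, regular (iter n sg w).

Lemma open_transfer_iter n (f : B S w) x :
  open_transfer S (iter n sg w) N (ev S (normalized_iter N n f)) x =
  lam S N (iter n sg w) * ev S (normalized_iter N n.+1 f) x.
Proof.
have [_ _ /(_ N)[h _]] := Hreg n.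
have [Jx|nJ] := pselect (J S (sg (iter n sg w)) x); last first.
  by rewrite open_transfer_out// (ev_out (ros_spaces hS))// mulr0.
rewrite /= (ev_linear (ros_spaces hS)) -h// mulrA mulfV ?mul1r//.
by rewrite gt_eqF// lam_gt0.
Qed.

Lemma nu_normalized_iter n (f : B S w) :
  \int[nu S N (iter n sg w)]_x ev S (normalized_iter N n f) x =
  \int[nu S N w]_x ev S f x.
Proof.
elim: n => // n <-.
have [_ [_ [_ [_ [_ [h _]]]]]] := hC2 N.
have := h _ (normalized_iter N n f).
under eq_Rintegral do rewrite open_transfer_iter.
rewrite RintegralZl//; last exact: integrable_ev.
by apply: mulfI; rewrite gt_eqF// lam_gt0.
Qed.

(** Since [Q] kills [phi], no cross terms arise and only the pure power of [Q] remains. *)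
Lemma Q_normalized_iter n (f : B S w) :
  Q N (iter n sg w) (normalized_iter N n f) = Qiter Q N n.+1 f.
Proof.
elim: n => // n IH.
have [_ _ /(_ N)[_ [h _]]] := Hreg n.+1.
by rewrite [normalized_iter _ _ _]/= linearD linearZ /= h scaler0 add0r IH.
Qed.

Lemma ev_normalized_iter n (f : B S w) x :
  ev S (normalized_iter N n.+1 f) x =
  (\int[nu S N w]_y ev S f y) * ev S (phi S N (iter n.+1 sg w)) x
  + ev S (Qiter Q N n.+1 f) x.
Proof.
by rewrite -Q_normalized_iter [normalized_iter _ _ _]/= nu_normalized_iter
  (ev_linear (ros_spaces hS)).
Qed.

Definition lam_ratio n v := lamn S n v 0 / lamn S n v N.

Lemma lam_ratioS n v : lam_ratio n.+1 v =
  (lam S 0 (iter n sg v) / lam S N (iter n sg v)) * lam_ratio n v.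
Proof. by rewrite /lam_ratio /lamn !big_ord_recr /= invfM; ring. Qed.

(** Each step moves one avoided visit from the end of the orbit to its start. The extra [k] carries
    the induction; later [k = 0] gives survival, and the difference of [k = 0] and [k = 1] gives a
    hit at time [n]. *)
Lemma conformal_iter n k (f : B S w) :
  \int[nu S 0 (iter n sg w)]_x
    (ev S (normalized_iter N n f) x * \1_(survp (iter n sg w) k N) x) =
  lam_ratio n w * \int[nu S 0 w]_x (ev S f x * \1_(survp w (n + k) N) x).
Proof.
elim: n k => [|n IH] k.
  by rewrite /lam_ratio /lamn !big_ord0 divr1 mul1r.
have l0 : lam S N (iter n sg w) != 0 by rewrite gt_eqF// lam_gt0.
rewrite lam_ratioS addSnnS -mulrA -IH.
have := conformal_open N k (normalized_iter N n f) (Hreg n).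
under eq_Rintegral do
  rewrite open_transfer_iter mulrCA [\1_(survp _ _ _) _ * _]mulrC.
rewrite RintegralZl//; last by apply: integrable_ev_indic; exact: measurable_survp.
by move=> h; apply: (mulfI l0); rewrite h /=; field; exact: l0.
Qed.

End Orbit.
End Integrals.
End Fibrewise.
End OpenSystem.

(** * First hits and return probabilities *)

Section FirstHits.
Context (R : realType) (d : measure_display) (Omega : measurableType d)
  (m : probability Omega R) (X : completePseudoMetricType R)
  (S : open_data Omega X) (hS : random_open_system m S) (hC2 : cond_C2 m S).

Local Notation sg := (sigma S).
Local Notation sgV := (sigmaV S).

Definition mur w (A : set X) : R :=
  \int[nu S 0 w]_x (ev S (phi S 0 w) x * \1_A x).

Lemma muE w A : @measurable _ (Borel X) A -> mu S w A = (mur w A)%:E.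
Proof.
move=> mA; rewrite /mur /Rintegral fineK; last first.
  apply: integrable_fin_num => //; exact: (integrable_ev_indic hC2 0 (phi S 0 w) mA).
rewrite /mu integral_mkcond; apply: eq_integral => x _.
by rewrite patchE indicE; case: (_ \in _); rewrite ?mulr1 ?mulr0.
Qed.

Lemma phi0_ge0 w x : 0 <= ev S (phi S 0 w) x.
Proof.
have [Jx|nJ] := pselect (J S w x); first exact/ltW/(phi0_gt0 (ros_CCM hS)).
by rewrite (ev_out (ros_spaces hS)).
Qed.

Lemma mur_ge0 w A : 0 <= mur w A.
Proof. by apply: Rintegral_ge0 => x _; rewrite mulr_ge0 ?phi0_ge0. Qed.

Lemma murB w A A' : @measurable _ (Borel X) A -> @measurable _ (Borel X) A' ->
  A' `<=` A -> mur w (A `\` A') = mur w A - mur w A'.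
Proof. exact: (Rintegral_ev_indicD hC2). Qed.

Lemma le_mur w A A' : @measurable _ (Borel X) A -> @measurable _ (Borel X) A' ->
  A' `<=` A -> mur w A' <= mur w A.
Proof. by move=> mA mA' sA; rewrite -subr_ge0 -murB// mur_ge0. Qed.

Lemma murDI w A H : @measurable _ (Borel X) A -> @measurable _ (Borel X) H ->
  mur w (A `\` H) = mur w A - mur w (A `&` H).
Proof.
move=> mA mH; rewrite -murB; [|by []|exact: measurableI|by move=> x []].
by congr mur; rewrite setDIr setDv set0U.
Qed.

Definition invariant w := forall A : set (Borel X), measurable A ->
  mu S w (J S w `&` Tmap S w @^-1` A) = mu S (sg w) A.

Lemma mur_inv w A : invariant w -> @measurable _ (Borel X) A ->
  mur w (J S w `&` Tmap S w @^-1` A) = mur (sg w) A.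
Proof.
move=> iw mA; have := iw A mA.
rewrite !muE//; first by case.
exact: (measurable_Tpreimage hS).
Qed.

Lemma measurable_Titer w n A : @measurable _ (Borel X) A ->
  @measurable _ (Borel X) [set x | J S w x /\ A (Titer S n w x)] /\
  ((forall j, invariant (iter j sg w)) ->
   mur w [set x | J S w x /\ A (Titer S n w x)] =
   mur (iter n sg w) (J S (iter n sg w) `&` A)).
Proof.
move=> mA; elim: n w => [|n IH] w.
  split => //; apply: measurableI => //; exact: (measurable_J hS).
have -> : [set x | J S w x /\ A (Titer S n.+1 w x)] =
    J S w `&` Tmap S w @^-1` [set x | J S (sg w) x /\ A (Titer S n (sg w) x)].
  apply/seteqP; split=> x.
    move=> [Jx]; rewrite TiterSr => Ax; split => //; split => //.
    exact: (T_maps (ros_base hS)).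
  by move=> [Jx [_ Ax]]; split => //; rewrite TiterSr.
have [m1 m2] := IH (sg w); split; first exact: (measurable_Tpreimage hS).
move=> iw; rewrite mur_inv//; last exact: (iw 0%N).
by rewrite m2 ?iterSr// => j; rewrite -iterSr.
Qed.

Definition first_hit w n N : set X := survp S w n N `\` survp S w n.+1 N.

Lemma first_hitE w n N x : first_hit w n N x <->
  survp S w n N x /\ hole S (iter n sg w) N (Titer S n w x).
Proof.
split=> [[sx nsx]|[sx Hx]]; split => //.
  apply: contrapT => nH; apply: nsx; have [Jx h] := sx; split => // j.
  by rewrite ltnS leq_eqVlt => /predU1P[->//|]; exact: h.
by move=> [_ /(_ n (ltnSn n))].
Qed.

Lemma measurable_first_hit w n N : @measurable _ (Borel X) (first_hit w n N).
Proof. by apply: measurableD; exact: (measurable_survp hS). Qed.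

Lemma first_hit0 w N : first_hit w 0 N = hole S w N.
Proof. by rewrite /first_hit survp0 survp1D. Qed.

(** Taken at [iter n.+1 sgV w], this is the event in the numerator of [qhat n N w]: a start in the
    hole whose first return happens at time [n + 1]. *)
Definition return_hit w n N : set X :=
  (J S w `&` Tmap S w @^-1` first_hit (sg w) n N) `&` hole S w N.

Lemma first_hitS w n N : first_hit w n.+1 N =
  (J S w `&` Tmap S w @^-1` first_hit (sg w) n N) `\` hole S w N.
Proof.
rewrite /first_hit !(survp_rec hS); apply/seteqP; split=> x.
  move=> [[[Jx nH] sx] ns]; split => //; split => //; split => // sx'.
  exact: ns.
by move=> [[Jx [sx ns]] nH]; split => // -[_ ].
Qed.

Lemma mur_first_hitS w n N : invariant w ->
  mur w (first_hit w n.+1 N) =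
  mur (sg w) (first_hit (sg w) n N) - mur w (return_hit w n N).
Proof.
move=> iw; rewrite first_hitS murDI ?mur_inv//.
- exact: measurable_first_hit.
- by apply: (measurable_Tpreimage hS); exact: measurable_first_hit.
- exact: (measurable_hole hS).
Qed.

Lemma iter_sigmaVK i n w : (i <= n)%N ->
  iter i sg (iter n sgV w) = iter (n - i) sgV w.
Proof.
elim: i n => [|i IH] [|n]//; rewrite ltnS subSS => /IH <-.
by rewrite iterSr iterS (sigmaVK (ros_base hS)).
Qed.

Lemma qhatE n N w : (forall j, invariant (iter j sg (iter n.+1 sgV w))) ->
  qhat S n N w =
  mur (iter n.+1 sgV w) (return_hit (iter n.+1 sgV w) n N) / mur w (hole S w N).
Proof.
move=> iw; rewrite /qhat; set w' := iter n.+1 sgV w.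
have w'E : iter n.+1 sg w' = w by rewrite iter_sigmaVK// subnn.
have [mhit muhit] := measurable_Titer w' n.+1 (measurable_hole hS w N).
congr (_ / _); last first.
  rewrite muE//= muhit// w'E; congr mur; apply/seteqP; split=> x; first by case.
  by move=> Hx; split => //; case: Hx.
transitivity (fine (mu S w' (return_hit w' n N))); last first.
  rewrite muE//; apply: measurableI; last exact: (measurable_hole hS).
  by apply: (measurable_Tpreimage hS); exact: measurable_first_hit.
congr (fine (mu S w' _)); apply/seteqP; split=> x.
  move=> [[[Jx Hx] av] H0]; split => //; split => //.
  apply/first_hitE; rewrite -TiterSr -iterSr w'E; split => //.
  split; first exact: (T_maps (ros_base hS)).
  move=> j jn; rewrite -TiterSr -iterSr.
  (* [qhat] numbers the avoided visits backwards from [w], [first_hit] forwards from [sg w']: visit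
     [j] of the latter is visit [n - j] of the former. *)
  have -> : iter j.+1 sg w' = iter (n - j) sgV w.
    by rewrite iter_sigmaVK ?subSS// ltnS ltnW.
  have jj : (1 <= n - j <= n)%N by rewrite subn_gt0 jn leq_subr.
  by have := av _ jj; rewrite subSn ?leq_subr// subKn 1?ltnW.
move=> [[Jx /first_hitE[[_ av] Hx]] H0].
rewrite -TiterSr -iterSr w'E in Hx.
split => //; split => // j /andP[j0 jn].
have jj : (n - j < n)%N by rewrite ltn_subrL j0 (leq_trans j0 jn).
have := av _ jj; rewrite -TiterSr -iterSr -subSn//.
by rewrite iter_sigmaVK ?leq_subr// subKn// leqW.
Qed.

(* Decompose a hit at time [n] according to the previous hit. *)
Lemma mur_first_hit n N w :
  (forall j k, invariant (iter j sg (iter k sgV w))) -> mur w (hole S w N) != 0 ->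
  mur (iter n sgV w) (first_hit (iter n sgV w) n N) =
  mur w (hole S w N) * (1 - \sum_(k < n) qhat S k N w).
Proof.
move=> iw w0; elim: n => [|n IH].
  by rewrite big_ord0 subr0 mulr1 first_hit0.
rewrite mur_first_hitS; last exact: (iw 0%N n.+1).
rewrite iterS (sigmaVK (ros_base hS)) IH big_ord_recr /=.
rewrite qhatE; last by move=> j; exact: iw.
rewrite iterS; field; exact: w0.
Qed.

(** A union bound over the hitting times; invariance carries each term to the fibre where the hit
    occurs. *)
Lemma mur_survp_compl w n N : (forall j, invariant (iter j sg w)) ->
  mur w (J S w `\` survp S w n N) <=
  \sum_(j < n) mur (iter j sg w) (hole S (iter j sg w) N).
Proof.
elim: n w => [|n IH] w iw.
  rewrite big_ord0 survp0 murB//; try exact: (measurable_J hS).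
  by rewrite subrr.
have mC k v : @measurable _ (Borel X) (J S v `\` survp S v k N).
  by apply: measurableD; [exact: (measurable_J hS)|exact: (measurable_survp hS)].
have mT := measurable_Tpreimage hS w (mC n (sg w)).
have mH := measurable_hole hS w N.
have mA := mC n.+1 w.
rewrite big_ord_recl /=; under eq_bigr do rewrite -iterS iterSr.
apply: (@le_trans _ _ (mur w (hole S w N) +
    mur w (J S w `&` Tmap S w @^-1` (J S (sg w) `\` survp S (sg w) n N)))).
  have -> : mur w (J S w `\` survp S w n.+1 N) =
      mur w ((J S w `\` survp S w n.+1 N) `\` hole S w N) +
      mur w ((J S w `\` survp S w n.+1 N) `&` hole S w N).
    by rewrite (murDI w mA mH) subrK.
  rewrite addrC lerD//; apply: le_mur => //.
  - exact: measurableI.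
  - exact: measurableD.
  - move=> x [[Jx nsx] nH]; split => //; split.
      exact: (T_maps (ros_base hS)).
    by apply: contra_not nsx; rewrite (survp_rec hS).
by rewrite lerD2l mur_inv//; [|exact: (iw 0%N)];
  apply: IH => j; rewrite -iterSr.
Qed.

End FirstHits.

(** * Spectral decomposition along an orbit *)

(** Neither limit is presupposed: closeness to a single [b n] makes [a] Cauchy, and [b] then
    inherits the limit. Applied to the partial sums of [qhat0], this also proves that their series
    converges. *)
Lemma double_limit (R : realType) (a b e : nat -> R) :
  (forall n (r : R), 0 < r -> \forall N \near \oo, `|a N - b n| <= e n + r) ->
  e @ \oo --> (0 : R) -> exists2 l : R, a @ \oo --> l & b @ \oo --> l.
Proof.
move=> ab e0.
have ca : cvgn a.
  apply/cauchy_cvgP/cauchy_ballP => r r0.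
  (* Through [b n], two late values of [a] differ by at most [2 (r/8 + r/8) = r/2]. *)
  have [n hn] : exists n, e n <= r / 8.
    near \oo => n; exists n; near: n.
    by apply: (cvgr_le _ e0); rewrite divr_gt0.
  have [M _ hM] := ab n (r / 8) (divr_gt0 r0 (ltr0Sn _ _)).
  pose A := a @` [set k | (M <= k)%N].
  have aA : (a @ \oo) A by exists M => // k /= Mk; exists k.
  exists (A, A) => // -[_ _] [/= [i /hM /= hi <-] [j /hM /= hj <-]].
  rewrite /ball /=.
  have := ler_distD (b n) (a i) (a j); rewrite (distrC (b n)) => h.
  lra.
have /cvg_ex[/= l al] := ca.
exists l => //.
have bl n : `|l - b n| <= e n.
  apply/ler_addgt0Pr => r r0.
  have c : `|a N - b n| @[N --> \oo] --> `|l - b n|.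
    by apply: cvg_norm; apply: cvgB => //; exact: cvg_cst.
  rewrite -(cvg_lim _ c)//; apply: limr_le; last exact: ab.
  by apply/cvg_ex; eexists; exact: c.
apply/cvgrPdist_le => r r0; near=> n.
apply: le_trans (bl n) _; near: n; exact: (cvgr_le _ e0).
Unshelve. all: by end_near. Qed.

Section Asymptotics.
Context (R : realType) (d : measure_display) (Omega : measurableType d)
  (m : probability Omega R) (X : completePseudoMetricType R)
  (S : open_data Omega X) (hS : random_open_system m S) (hC2 : cond_C2 m S)
  (Q : nat -> forall w, {linear B S w -> B S (sigma S w)}).

Local Notation sg := (sigma S).
Local Notation sgV := (sigmaV S).
Local Notation regular := (regular Q).

Definition hole_mass N w : R :=
  \int[nu S 0 w]_x (ev S (phi S N w) x * \1_(hole S w N) x).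

Lemma lam_gap N w : regular w -> regular (sg w) ->
  1 - lam S N w / lam S 0 w = hole_mass N w.
Proof.
move=> rw [_ r1 _]; have l0 := lam_gt0 hC2 0 w.
have := conformal_open hS N 0 (phi S N w) rw.
have -> : \int[nu S 0 (sg w)]_x
    (\1_(survp S (sg w) 0 N) x * open_transfer S w N (ev S (phi S N w)) x) =
    \int[nu S 0 (sg w)]_x (lam S N w * ev S (phi S N (sg w)) x).
  apply: eq_Rintegral => x _; rewrite survp0 indicE.
  have [_ [_ [_ [_ [h _]]]]] := hC2 N.
  case: (boolP (x \in _)) => [|]; rewrite ?inE ?notin_setE => Jx.
    by rewrite mul1r h.
  by rewrite mul0r (ev_out (ros_spaces hS))// mulr0.
rewrite RintegralZl//; last exact: (integrable_ev hC2).
rewrite r1 mulr1 => ->; have [_ /(_ N) rN _] := rw.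
rewrite /hole_mass -survp1D (Rintegral_ev_indicD hC2); first last.
- by move=> x [].
- exact: (measurable_survp hS).
- exact: (measurable_J hS).
have -> : \int[nu S 0 w]_x (ev S (phi S N w) x * \1_(J S w) x) = 1.
  by rewrite -rN; apply: eq_Rintegral => x _; rewrite (ev_J hS).
by congr (1 - _); rewrite mulrAC mulfV ?mul1r// gt_eqF.
Qed.

Lemma lamn_gt0 n w N : 0 < lamn S n w N.
Proof. by apply: prodr_gt0 => j _; exact: (lam_gt0 hC2). Qed.

Section Orbit.
Variables (w : Omega) (Hreg : forall n, regular (iter n sg w)).

(** The spectral decomposition after [n + 1] steps, integrated against [nu 0] over the whole final
    fibre; [phi N] has integral one there. *)
Lemma nu_survp N n (f : B S w) :
  \int[nu S N w]_x ev S f x +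
    \int[nu S 0 (iter n.+1 sg w)]_x ev S (Qiter Q N n.+1 f) x =
  lam_ratio S N n.+1 w * \int[nu S 0 w]_x (ev S f x * \1_(survp S w n.+1 N) x).
Proof.
have := conformal_iter hS hC2 N Hreg n.+1 0 f; rewrite addn0 => <-.
have [_ /(_ N) r1 _] := Hreg n.+1.
under [RHS]eq_Rintegral do rewrite survp0 (ev_J hS) (ev_normalized_iter hS hC2 _ Hreg).
rewrite RintegralD//; last exact: (integrable_ev hC2).
  by rewrite RintegralZl ?r1 ?mulr1//; exact: (integrable_ev hC2).
exact: (integrableZl measurableT _ (integrable_ev hC2 _ _)).
Qed.

(** The same decomposition integrated over the hole in the final fibre: on the original fibre this
    selects the points whose first hit is at time [n + 1]. *)
Lemma nu_hole N n (f : B S w) (v := iter n.+1 sg w) :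
  (\int[nu S N w]_x ev S f x) * hole_mass N v +
    \int[nu S 0 v]_x (ev S (Qiter Q N n.+1 f) x * \1_(hole S v N) x) =
  lam_ratio S N n.+1 w *
    \int[nu S 0 w]_x (ev S f x * \1_(first_hit S w n.+1 N) x).
Proof.
have mH := measurable_hole hS v N.
have mS k := measurable_survp hS w k N.
rewrite /first_hit (Rintegral_ev_indicD hC2)//; last exact: survp_nonincr.
have := conformal_iter hS hC2 N Hreg n.+1 1 f.
have := conformal_iter hS hC2 N Hreg n.+1 0 f.
rewrite mulrBr addn0 addn1 => <- <-; rewrite -/v -(Rintegral_ev_indicD hC2).
- rewrite survp0 survp1D.
  under [RHS]eq_Rintegral do rewrite (ev_normalized_iter hS hC2 _ Hreg) mulrDl -mulrA.
  rewrite RintegralD//; last exact: (integrable_ev_indic hC2).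
    by rewrite RintegralZl//; exact: (integrable_ev_indic hC2).
  exact: (integrableZl measurableT _ (integrable_ev_indic hC2 _ _ mH)).
- exact: (measurable_survp hS).
- exact: (measurable_survp hS).
- exact: survp_nonincr.
Qed.

Lemma Rintegral_Qiter N n (f : B S w) (a : R) :
  (Linfty_norm S (iter n.+1 sg w) (ev S (Qiter Q N n.+1 f)) <= a%:E)%E ->
  `|\int[nu S 0 (iter n.+1 sg w)]_x ev S (Qiter Q N n.+1 f) x| <= a.
Proof.
move/(Rintegral_ev_bound hS hC2 measurableT).
rewrite (nu0_prob (ros_CCM hS)) mulr1; congr (`|_| <= _).
by apply: eq_Rintegral => x _; rewrite indicT mulr1.
Qed.

Lemma lam_ratio_cvg n : (forall j, hole_mass ^~ (iter j sg w) @ \oo --> (0 : R)) ->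
  (lam_ratio S N n w) @[N --> \oo] --> (1 : R).
Proof.
move=> h; elim: n => [|n IH].
  rewrite /lam_ratio /lamn.
  under eq_fun do rewrite !big_ord0 divr1; exact: cvg_cst.
have -> : (fun N => lam_ratio S N n.+1 w) =
    (fun N => (1 - hole_mass N (iter n sg w))^-1 * lam_ratio S N n w).
  apply/funext => N; rewrite lam_ratioS -(lam_gap N (Hreg n) (Hreg n.+1)).
  by rewrite subKr invf_div.
have h1 : 1 - hole_mass N (iter n sg w) @[N --> \oo] --> (1 - 0 : R).
  by apply: cvgB; [exact: cvg_cst|exact: (h n)].
have h2 : (1 - hole_mass N (iter n sg w))^-1 @[N --> \oo] --> ((1 - 0)^-1 : R).
  by apply: cvgV => //; rewrite subr0 oner_neq0.
have h3 : (1 - hole_mass N (iter n sg w))^-1 * lam_ratio S N n w @[N --> \oo]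
    --> ((1 - 0)^-1 * 1 : R) by exact: cvgM.
by rewrite mulr1 subr0 invr1 in h3.
Qed.

Hypothesis Hinv : forall n, invariant S (iter n sg w).
Hypothesis Hhm : forall n, hole_mass ^~ (iter n sg w) @ \oo --> (0 : R).
Hypothesis Hmur : forall n,
  (fun N => mur S (iter n sg w) (hole S (iter n sg w) N)) @ \oo --> (0 : R).
Variables (f : B S w) (c : R) (c0 : 0 <= c).
Hypothesis fc : forall x, J S w x -> 0 <= ev S f x <= c * ev S (phi S 0 w) x.

(** Domination by [phi 0] replaces [nu 0] by the invariant [mu], for which the finitely many hole
    measures along the orbit can be summed, and each tends to zero. *)
Lemma Rintegral_survp_cvg n :
  \int[nu S 0 w]_x (ev S f x * \1_(survp S w n N) x) @[N --> \oo] -->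
  \int[nu S 0 w]_x ev S f x.
Proof.
have mS k N := measurable_survp hS w k N.
have mJ := measurable_J hS w.
have -> : \int[nu S 0 w]_x ev S f x = \int[nu S 0 w]_x (ev S f x * \1_(J S w) x).
  by apply: eq_Rintegral => x _; rewrite (ev_J hS).
have cs : c * \sum_(j < n) mur S (iter j sg w) (hole S (iter j sg w) N)
    @[N --> \oo] --> (0 : R).
  have c1 : \sum_(j < n) mur S (iter j sg w) (hole S (iter j sg w) N)
      @[N --> \oo] --> \sum_(j < n) (0 : R).
    by apply: cvg_big => //; exact: add_continuous.
  have c2 : c * \sum_(j < n) mur S (iter j sg w) (hole S (iter j sg w) N)
    @[N --> \oo] --> c * \sum_(j < n) (0 : R) by exact: cvgMr.
  by rewrite big1// mulr0 in c2.
apply/cvgrPdist_le => r r0; near=> N.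
rewrite -(Rintegral_ev_indicD hC2)//; last by move=> x [].
have fc' x : 0 <= ev S f x <= c * ev S (phi S 0 w) x.
  have [Jx|nJ] := pselect (J S w x); first exact: fc.
  by rewrite !(ev_out (ros_spaces hS))// mulr0 lexx.
have mA : @measurable _ (Borel X) (J S w `\` survp S w n N) by exact: measurableD.
rewrite ger0_norm; last first.
  by apply: Rintegral_ge0 => x _; rewrite mulr_ge0//; case/andP: (fc' x).
apply: (@le_trans _ _ (c * mur S w (J S w `\` survp S w n N))).
  rewrite /mur -RintegralZl//; last exact: (integrable_ev_indic hC2).
  apply: le_Rintegral => //; first exact: (integrable_ev_indic hC2).
    exact: (integrableZl measurableT _ (integrable_ev_indic hC2 _ _ mA)).
  by move=> x _; rewrite mulrA ler_wpM2r//; case/andP: (fc' x).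
apply: (@le_trans _ _ (c * \sum_(j < n) mur S (iter j sg w) (hole S (iter j sg w) N))).
  by rewrite ler_wpM2l// (mur_survp_compl hS hC2).
near: N; exact: (cvgr_le _ cs).
Unshelve. all: by end_near. Qed.

(** For fixed [n], the right side of [nu_survp] tends to the [nu 0]-integral of [f], and the [Q]
    term is at most [a n] for all [N]. The comparison sequence [b] is constant, which identifies the
    limit. *)
Lemma nu_cvg (a : nat -> R) : a @ \oo --> (0 : R) ->
  (forall n N, (Linfty_norm S (iter n.+1 sg w) (ev S (Qiter Q N n.+1 f)) <= (a n)%:E)%E) ->
  \int[nu S N w]_x ev S f x @[N --> \oo] --> \int[nu S 0 w]_x ev S f x.
Proof.
move=> a0 Qa.
pose b (n : nat) := \int[nu S 0 w]_x ev S f x.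
have ab n r : 0 < r -> \forall N \near \oo, `|\int[nu S N w]_x ev S f x - b n| <= a n + r.
  move=> r0.
  have c1 : lam_ratio S N n.+1 w *
      \int[nu S 0 w]_x (ev S f x * \1_(survp S w n.+1 N) x)
      @[N --> \oo] --> 1 * b n.
    by apply: cvgM; [exact: lam_ratio_cvg|exact: Rintegral_survp_cvg].
  rewrite mul1r in c1; move/cvgrPdist_le : c1 => /(_ _ r0) c1; near=> N.
  have h1 : `|b n - lam_ratio S N n.+1 w *
      \int[nu S 0 w]_x (ev S f x * \1_(survp S w n.+1 N) x)| <= r.
    by near: N; exact: c1.
  have h2 := Rintegral_Qiter (Qa n N).
  rewrite -nu_survp in h1.
  move: h1 h2; rewrite !ler_norml => /andP[h1 h1'] /andP[h2 h2'].
  by apply/andP; split; lra.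
have [l nul bl] := double_limit ab a0.
have lb : l = b 0%N by rewrite -(cvg_lim _ bl)//; exact: lim_cst.
by rewrite lb in nul.
Unshelve. all: by end_near. Qed.

(** [nu_survp] on the diagonal, with as many steps as the index of the hole. This is possible
    because [a] bounds the [Q] terms for all holes at once. *)
Lemma survival_cvg (a : nat -> R) (L : R) : a @ \oo --> (0 : R) ->
  (forall n N, (Linfty_norm S (iter n.+1 sg w) (ev S (Qiter Q N n.+1 f)) <= (a n)%:E)%E) ->
  lamn S N w N / lamn S N w 0 @[N --> \oo] --> L ->
  \int[nu S 0 w]_x (ev S f x * \1_(survp S w N N) x) @[N --> \oo] -->
    L * \int[nu S 0 w]_x ev S f x.
Proof.
move=> a0 Qa lamL.
have nuf := nu_cvg a0 Qa.
have Q0 : \int[nu S 0 (iter n.+1 sg w)]_x ev S (Qiter Q n.+1 n.+1 f) x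
    @[n --> \oo] --> (0 : R).
  apply: norm_cvg0; apply: (@squeeze_cvgr _ _ _ _ (cst 0) a) => //; last exact: cvg_cst.
  by near=> n; rewrite normr_ge0 /= Rintegral_Qiter.
rewrite -cvg_shiftS /=.
have nuf1 : \int[nu S n.+1 w]_x ev S f x @[n --> \oo] --> \int[nu S 0 w]_x ev S f x.
  by rewrite -cvg_shiftS in nuf.
have lamL1 : lamn S n.+1 w n.+1 / lamn S n.+1 w 0 @[n --> \oo] --> L.
  by rewrite -cvg_shiftS in lamL.
have h : lamn S n.+1 w n.+1 / lamn S n.+1 w 0 *
    (\int[nu S n.+1 w]_x ev S f x +
     \int[nu S 0 (iter n.+1 sg w)]_x ev S (Qiter Q n.+1 n.+1 f) x)
    @[n --> \oo] --> L * (\int[nu S 0 w]_x ev S f x + 0).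
  by apply: cvgM => //; exact: cvgD.
rewrite addr0 in h; 
suff -> : (fun n => \int[nu S 0 w]_x (ev S f x * \1_(survp S w n.+1 n.+1) x)) =
  (fun n => lamn S n.+1 w n.+1 / lamn S n.+1 w 0 *
    (\int[nu S n.+1 w]_x ev S f x +
     \int[nu S 0 (iter n.+1 sg w)]_x ev S (Qiter Q n.+1 n.+1 f) x)) by [].
apply/funext => n; rewrite nu_survp mulrA /lam_ratio.
by rewrite -[_ / lamn _ _ _ 0]invf_div mulVf ?mul1r// gt_eqF// divr_gt0// lamn_gt0.
Unshelve. all: by end_near. Qed.

End Orbit.
End Asymptotics.

(** * First-order response of the leading multiplier *)

Section EscapeRate.
Context (R : realType) (d : measure_display) (Omega : measurableType d)
  (m : probability Omega R) (X : completePseudoMetricType R)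
  (S : open_data Omega X) (hS : random_open_system m S) (hC2 : cond_C2 m S)
  (Q : nat -> forall w, {linear B S w -> B S (sigma S w)}).

Local Notation sg := (sigma S).
Local Notation sgV := (sigmaV S).

Lemma nu0_le_mur w (A : set X) (C3 : R) : @measurable _ (Borel X) A ->
  A `<=` J S w -> (forall x, J S w x -> 1 <= C3 * ev S (phi S 0 w) x) ->
  fine (nu S 0 w A) <= C3 * mur S w A.
Proof.
move=> mA AJ h; rewrite /mur -RintegralZl//; last exact: (integrable_ev_indic hC2).
have -> : fine (nu S 0 w A) = \int[nu S 0 w]_x \1_A x.
  by rewrite /Rintegral integral_indic// setIT.
apply: le_Rintegral => //.
- apply: measurable_bounded_integrable => //; first exact: (nu0_fin hS).
  exists 1; split; first exact: num_real.
  move=> M M1 x _ /=; rewrite indicE (le_trans _ (ltW M1))//.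
  by case: (_ \in _); rewrite ?normr1 ?normr0 ?ler01.
- exact: (integrableZl measurableT _ (integrable_ev_indic hC2 _ _ mA)).
move=> x _; rewrite indicE; case: (boolP (x \in A)); rewrite ?mulr0 ?mulr1//.
by rewrite inE => /AJ; exact: h.
Qed.

Lemma hole_mass_le N w (C2 C3 : R) : 0 <= C2 ->
  (forall x, J S w x -> 1 <= C3 * ev S (phi S 0 w) x) ->
  (Linfty_norm S w (ev S (phi S N w)) <= C2%:E)%E ->
  `|hole_mass S N w| <= C2 * C3 * mur S w (hole S w N).
Proof.
move=> C20 h3 h2; apply: (le_trans (Rintegral_ev_bound hS hC2 (measurable_hole hS w N) h2)).
rewrite -mulrA ler_wpM2l// nu0_le_mur//; first exact: (measurable_hole hS).
by move=> x [].
Qed.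

(** Dividing [nu_hole] for [phi 0] by the measure of the hole leaves [1 - \sum qhat], up to factors
    tending to one and a [Q] term. That term is also an integral over the hole, so it stays bounded
    by [a n * C3] after the division. *)
Lemma theta0_cvg v (a : nat -> R) (C2 C3 : R) :
  (forall k j, regular Q (iter j sg (iter k sgV v))) ->
  (forall k j, invariant S (iter j sg (iter k sgV v))) ->
  (forall k j, hole_mass S ^~ (iter j sg (iter k sgV v)) @ \oo --> (0 : R)) ->
  (forall k j, (fun N => mur S (iter j sg (iter k sgV v))
     (hole S (iter j sg (iter k sgV v)) N)) @ \oo --> (0 : R)) ->
  0 <= C2 -> 0 <= C3 ->
  (forall x, J S v x -> 1 <= C3 * ev S (phi S 0 v) x) ->
  (forall N, (Linfty_norm S v (ev S (phi S N v)) <= C2%:E)%E) ->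
  a @ \oo --> (0 : R) ->
  (forall k n N, (Linfty_norm S (iter n.+1 sg (iter k sgV v))
     (ev S (Qiter Q N n.+1 (phi S 0 (iter k sgV v)))) <= (a n)%:E)%E) ->
  (forall N, (0 < N)%N -> 0 < mur S v (hole S v N)) ->
  (forall k, cvgn (fun N => qhat S k N v)) ->
  hole_mass S N v / mur S v (hole S v N) @[N --> \oo] --> theta0 S v.
Proof.
move=> Hreg Hinv Hhm Hmur C20 C30 h3 h2 a0 Qa Hpos Hq.
pose A N := hole_mass S N v / mur S v (hole S v N).
pose b n := 1 - \sum_(k < n.+1) qhat0 S k v.
have AM : \forall N \near \oo, `|A N| <= C2 * C3.
  near=> N; have H0 : 0 < mur S v (hole S v N).
    by apply: Hpos; near: N; exact: nbhs_infty_gt.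
  rewrite normrM normfV (gtr0_norm H0) ler_pdivrMr//.
  exact: hole_mass_le.
have Ab n r : 0 < r -> \forall N \near \oo, `|A N - b n| <= a n * C3 + r.
  move=> r0; pose w := iter n.+1 sgV v.
  have wv : iter n.+1 sg w = v by rewrite (iter_sigmaVK hS)// subnn.
  pose nuphi N := \int[nu S N w]_x ev S (phi S 0 w) x.
  pose qN N := 1 - \sum_(k < n.+1) qhat S k N v.
  have c1 : nuphi N @[N --> \oo] --> (1 : R).
    have [_ /(_ 0%N) <- _] := Hreg n.+1 0%N.
    apply: (nu_cvg hS hC2 (Hreg n.+1) (Hinv n.+1) (Hhm n.+1) (Hmur n.+1) ler01 _ a0).
      by move=> x Jx; rewrite mul1r lexx andbT (phi0_ge0 hS).
    exact: Qa.
  have c2 : lam_ratio S N n.+1 w @[N --> \oo] --> (1 : R).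
    exact: (lam_ratio_cvg hS hC2 (Hreg n.+1)).
  have c3 : qN N @[N --> \oo] --> b n.
    apply: cvgB; first exact: cvg_cst.
    by apply: cvg_big => [|k _]; [exact: add_continuous|exact: Hq].
  pose err N := `|1 - nuphi N| * (C2 * C3) + `|lam_ratio S N n.+1 w * qN N - b n|.
  have cerr : err N @[N --> \oo] --> (`|1 - 1| * (C2 * C3) + `|1 * b n - b n| : R).
    apply: cvgD.
      apply: cvgMl; apply: cvg_norm; apply: cvgB => //; exact: cvg_cst.
    apply: cvg_norm; apply: cvgB; last exact: cvg_cst.
    exact: cvgM.
  rewrite subrr normr0 mul0r mul1r subrr normr0 addr0 in cerr.
  near=> N.
  have H0 : 0 < mur S v (hole S v N).
    by apply: Hpos; near: N; exact: nbhs_infty_gt.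
  have errN : err N <= r by near: N; exact: (cvgr_le _ cerr).
  have AMN : `|A N| <= C2 * C3 by near: N.
  pose rest := \int[nu S 0 (iter n.+1 sg w)]_x
    (ev S (Qiter Q N n.+1 (phi S 0 w)) x * \1_(hole S (iter n.+1 sg w) N) x).
  have hrest : `|rest| <= a n *
      fine (nu S 0 (iter n.+1 sg w) (hole S (iter n.+1 sg w) N)).
    apply: (Rintegral_ev_bound hS hC2 (measurable_hole hS _ N)); exact: Qa.
  have E : nuphi N * hole_mass S N (iter n.+1 sg w) + rest =
      lam_ratio S N n.+1 w * mur S w (first_hit S w n.+1 N).
    exact: (nu_hole hS hC2 (Hreg n.+1)).
  rewrite (mur_first_hit hS hC2 n.+1 (fun j k => Hinv k j)) ?gt_eqF// -/(qN N) in E.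
  (* The integrand in [rest] has a type depending on [iter n.+1 sg w], which blocks rewriting to
     [v]; only the value of [rest] and its bound matter from here on. *)
  clearbody rest; rewrite wv in hrest E.
  have {}hrest : `|rest| <= a n * C3 * mur S v (hole S v N).
    apply: (le_trans hrest); rewrite -mulrA ler_wpM2l//.
      by rewrite -lee_fin; apply: le_trans (Qa 0%N n N); exact: Lnorm_ge0.
    apply: nu0_le_mur => //; first exact: (measurable_hole hS).
    by move=> x [].
  have E2 : A N * nuphi N = lam_ratio S N n.+1 w * qN N - rest / mur S v (hole S v N).
    rewrite /A.
    have -> : lam_ratio S N n.+1 w * qN N =
      (lam_ratio S N n.+1 w * (mur S v (hole S v N) * qN N)) / mur S v (hole S v N).
      by field; rewrite gt_eqF.
    by rewrite -E; field; rewrite gt_eqF.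
  have -> : A N - b n = A N * (1 - nuphi N) +
     (lam_ratio S N n.+1 w * qN N - b n) - rest / mur S v (hole S v N).
    by rewrite mulrBr E2; ring.
  have h1 : `|rest / mur S v (hole S v N)| <= a n * C3.
    by rewrite normrM normfV (gtr0_norm H0) ler_pdivrMr.
  apply: (le_trans (ler_normB _ _)); rewrite addrC lerD//.
  apply: (le_trans (ler_normD _ _)); apply: le_trans errN; rewrite lerD2r.
  by rewrite normrM mulrC ler_wpM2l.
have aC : (fun n => a n * C3) @ \oo --> (0 : R).
  by rewrite -(mul0r C3); apply: cvgMl.
have [l Al bl] := double_limit Ab aC.
suff -> : theta0 S v = l by [].
have sl : series (fun k => qhat0 S k v) @ \oo --> 1 - l.
  rewrite -cvg_shiftS /=.
  have -> : (fun n => series (fun k => qhat0 S k v) n.+1) = (fun n => 1 - b n).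
    by apply/funext => n; rewrite /series /= /b subKr big_mkord.
  by apply: cvgB => //; exact: cvg_cst.
by rewrite /theta0 (cvg_lim _ sl)// subKr.
Unshelve. all: by end_near. Qed.

End EscapeRate.

(** * Typical base points *)

Lemma Lfun_infty_ae_bound (d : measure_display) (T : measurableType d)
    (R : realType) (m : probability T R) (f : T -> R) :
  f \in Lfun m +oo%E -> exists2 c, 0 <= c & {ae m, forall x, `|f x| <= c}.
Proof.
move=> /andP[_]; rewrite inE /= /finite_norm => foo.
have f0 : (0 <= Lnorm m +oo (EFin \o f))%E by exact: Lnorm_ge0.
have ffin : Lnorm m +oo (EFin \o f) \is a fin_num by rewrite ge0_fin_numE.
exists (fine (Lnorm m +oo (EFin \o f))); first exact: fine_ge0.
have : (Lnorm m +oo (EFin \o f) <= (fine (Lnorm m +oo (EFin \o f)))%:E)%E.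
  by rewrite fineK.
have m0 : (0 < m setT)%E by rewrite (probability_setT m) lte01.
rewrite [in X in (X <= _)%E -> _]unlock m0 => /ess_supP.
by apply: filterS => x /=; rewrite lee_fin.
Qed.

Lemma summable_cvg0 (R : realType) (u : nat -> R) :
  (forall n, (1 <= n)%N -> 0 < u n) -> (\sum_(1 <= n <oo) (u n)%:E < +oo)%E ->
  (fun n => u n.+1) @ \oo --> (0 : R).
Proof.
move=> u0 uoo; apply: cvg_series_cvg_0; apply: nondecreasing_is_cvgn.
  apply/nondecreasing_seqP => n.
  by rewrite /series /= big_nat_recr//= lerDl ltW// u0.
have sfin : (\sum_(1 <= n <oo) (u n)%:E)%E \is a fin_num.
  rewrite ge0_fin_numE//; apply: nneseries_ge0 => n n1 _.
  by rewrite lee_fin ltW// u0.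
exists (fine (\sum_(1 <= n <oo) (u n)%:E)%E) => _ [n _ <-].
rewrite -lee_fin fineK//.
have h : (\sum_(1 <= k < n.+1) (u k)%:E <= \sum_(1 <= k <oo) (u k)%:E)%E.
  by apply: nneseries_lim_ge => k k1 _; rewrite lee_fin ltW// u0.
by apply: le_trans h; rewrite sumEFin lee_fin /series /= big_add1.
Qed.

Section Typical.
Context (R : realType) (d : measure_display) (Omega : measurableType d)
  (m : probability Omega R) (X : completePseudoMetricType R)
  (S : open_data Omega X) (hS : random_open_system m S) (hC2 : cond_C2 m S)
  (Q : nat -> forall w, {linear B S w -> B S (sigma S w)}).

Local Notation sg := (sigma S).
Local Notation sgV := (sigmaV S).

(** The bound on the iterates of [phi 0] is uniform in [w], as the backward expansion requires. The
    one for [one] retains the norm of [one w], for which no uniform bound is given, and serves at a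
    fixed base point. *)
Record typical (one : forall w, B S w) (t : Omega -> R) (xi : nat -> Omega -> R)
    (C2 C3 W M : R) (a a1 : nat -> R) (N0 : nat) (w : Omega) : Prop := Typical {
  typ_regular : regular Q w ;
  typ_invariant : invariant S w ;
  typ_phi0 : forall x, J S w x -> 1 <= C3 * ev S (phi S 0 w) x ;
  typ_phi_ge0 : forall N, (N0 <= N)%N -> forall x, J S w x -> 0 <= ev S (phi S N w) x ;
  typ_phi_le : forall N, (Linfty_norm S w (ev S (phi S N w)) <= C2%:E)%E ;
  typ_hole : forall N, (0 < N)%N -> mu S w (hole S w N) = ((t w + xi N w) / N%:R)%:E ;
  typ_t_gt0 : 0 < t w ;
  typ_t_le : `|t w| <= M ;
  typ_xi_cvg : xi ^~ w @ \oo --> (0 : R) ;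
  typ_xi_le : forall N, (0 < N)%N -> `|xi N w| <= W ;
  typ_Q_phi0 : forall n N, (Linfty_norm S (iter n.+1 sg w)
     (ev S (Qiter Q N n.+1 (phi S 0 w))) <= (a n)%:E)%E ;
  typ_Q_one : forall n N, (Linfty_norm S (iter n.+1 sg w)
     (ev S (Qiter Q N n.+1 (one w))) <= (a1 n * `|one w|)%:E)%E ;
  typ_C8 : Omega_plus S w -> forall k, cvgn (fun N => qhat S k N w) }.

Section Point.
Variables (one : forall w, B S w) (t : Omega -> R) (xi : nat -> Omega -> R)
  (C2 C3 W M : R) (a a1 : nat -> R) (N0 : nat).
Hypotheses (oneE : forall w, ev S (one w) = \1_(J S w)) (C20 : 0 <= C2)
  (C30 : 0 <= C3) (a0 : a @ \oo --> (0 : R)) (a10 : a1 @ \oo --> (0 : R)).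
Local Notation typ := (typical one t xi C2 C3 W M a a1 N0).

Lemma typ_mur w N : typ w -> (0 < N)%N ->
  mur S w (hole S w N) = (t w + xi N w) / N%:R.
Proof.
move=> tw N1; have := typ_hole tw N1.
rewrite (muE hC2); last exact: (measurable_hole hS).
by case.
Qed.

Lemma typ_mur_cvg w : typ w ->
  (fun N => mur S w (hole S w N)) @ \oo --> (0 : R).
Proof.
move=> tw.
have h : (t w + xi N w) * N%:R^-1 @[N --> \oo] --> ((t w + 0) * 0 : R).
  apply: cvgM; last exact: cvg_invn.
  by apply: cvgD; [exact: cvg_cst|exact: (typ_xi_cvg tw)].
rewrite mulr0 in h; apply: cvg_trans h; apply: near_eq_cvg; near=> N.
rewrite typ_mur//; near: N; exact: nbhs_infty_gt.
Unshelve. all: by end_near. Qed.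

Lemma typ_hole_mass_cvg w : typ w -> hole_mass S ^~ w @ \oo --> (0 : R).
Proof.
move=> tw; apply: norm_cvg0.
have h : C2 * C3 * mur S w (hole S w N) @[N --> \oo] --> (C2 * C3 * 0 : R).
  by apply: cvgMr; exact: typ_mur_cvg.
rewrite mulr0 in h; have z0 : (fun _ : nat => 0 : R) @ \oo --> (0 : R) by exact: cvg_cst.
apply: squeeze_cvgr z0 h.
near=> N; rewrite normr_ge0 /=.
exact: (hole_mass_le hS hC2 C20 (typ_phi0 tw) (typ_phi_le tw N)).
Unshelve. all: by end_near. Qed.

Lemma typ_hole_mass_bound w N : typ w -> (N0 <= N)%N -> (0 < N)%N ->
  0 <= hole_mass S N w <= C2 * C3 * (M + W) / N%:R.
Proof.
move=> tw NN N1; apply/andP; split.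
  apply: Rintegral_ge0 => x _; apply: mulr_ge0 => //.
  have [Jx|nJ] := pselect (J S w x); first exact: (typ_phi_ge0 tw).
  by rewrite (ev_out (ros_spaces hS)).
apply: (le_trans (ler_norm _)).
apply: (le_trans (hole_mass_le hS hC2 C20 (typ_phi0 tw) (typ_phi_le tw N))).
rewrite typ_mur// mulrA ler_pM2r ?invr_gt0 ?ltr0n//.
rewrite ler_wpM2l ?mulr_ge0// lerD//.
  exact: le_trans (ler_norm _) (typ_t_le tw).
exact: le_trans (ler_norm _) (typ_xi_le tw N1).
Qed.

(** As [t w > 0], the scaling gives positive mass for large indices; the decreasing holes extend
    this to all. Hence typical points lie in [Omega_plus], where [cond_C8] applies. *)
Lemma typ_mur_gt0 w N : typ w -> (0 < N)%N -> 0 < mur S w (hole S w N).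
Proof.
move=> tw N1.
have h : t w + xi n w @[n --> \oo] --> (t w + 0 : R).
  by apply: cvgD; [exact: cvg_cst|exact: (typ_xi_cvg tw)].
rewrite addr0 in h.
have [K hK] : exists K, (N <= K)%N /\ 0 < t w + xi K w.
  near \oo => K; exists K; split; near: K; first exact: nbhs_infty_ge.
  exact: (cvgr_gt _ h _ (typ_t_gt0 tw)).
have [NK tK] := hK.
have K0 : (0 < K)%N by exact: leq_trans NK.
apply: (@lt_le_trans _ _ (mur S w (hole S w K))).
  by rewrite typ_mur// divr_gt0// ltr0n.
apply: (le_mur hS hC2); [exact: (measurable_hole hS)|exact: (measurable_hole hS)|].
exact: (ros_A hS).
Unshelve. all: by end_near. Qed.

Lemma typ_Omega_plus w : typ w -> Omega_plus S w.
Proof.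
move=> tw N N1; rewrite (muE hC2); last exact: (measurable_hole hS).
by rewrite lte_fin typ_mur_gt0.
Qed.

Variables (v : Omega) (Tv : forall k j, typ (iter j sg (iter k sgV v))).

Lemma scaled_gap_cvg :
  N%:R * (1 - lam S N v / lam S 0 v) @[N --> \oo] --> t v * theta0 S v.
Proof.
have T0 : typ v by exact: (Tv 0%N 0%N).
have h : hole_mass S N v / mur S v (hole S v N) @[N --> \oo] --> theta0 S v.
  apply: (theta0_cvg hS hC2 _ _ _ _ C20 C30 (typ_phi0 T0) (typ_phi_le T0) a0).
  - by move=> k j; exact: typ_regular (Tv k j).
  - by move=> k j; exact: typ_invariant (Tv k j).
  - by move=> k j; exact: typ_hole_mass_cvg (Tv k j).
  - by move=> k j; exact: typ_mur_cvg (Tv k j).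
  - by move=> k; exact: typ_Q_phi0 (Tv k 0%N).
  - by move=> N; exact: typ_mur_gt0.
  - exact/(typ_C8 T0)/typ_Omega_plus.
have h2 : t v + xi n v @[n --> \oo] --> (t v + 0 : R).
  by apply: cvgD; [exact: cvg_cst|exact: (typ_xi_cvg T0)].
rewrite addr0 in h2; have h3 := cvgM h2 h.
apply: cvg_trans (h3 _); apply: near_eq_cvg; near=> N.
have N1 : (0 < N)%N by near: N; exact: nbhs_infty_gt.
have H0 := typ_mur_gt0 T0 N1.
rewrite (lam_gap hS hC2 N (typ_regular T0) (typ_regular (Tv 0 1)))/=.
have -> : t v + xi N v = N%:R * mur S v (hole S v N).
  by rewrite typ_mur// mulrC divfK// pnatr_eq0 -lt0n.
by field; rewrite gt_eqF.
Unshelve. all: by end_near. Qed.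

Lemma typ_survival_cvg (L : R) :
  lamn S N v N / lamn S N v 0 @[N --> \oo] --> L ->
  fine (nu S 0 v (surv S v N.-1 N)) @[N --> \oo] --> L /\
  fine (mu S v (surv S v N.-1 N)) @[N --> \oo] --> L.
Proof.
move=> lamL.
have Hreg j := typ_regular (Tv 0 j).
have Hinv j := typ_invariant (Tv 0 j).
have Hhm j := typ_hole_mass_cvg (Tv 0 j).
have Hmur j := typ_mur_cvg (Tv 0 j).
have T0 : typ v by exact: (Tv 0%N 0%N).
have [_ /(_ 0%N) r1 _] := typ_regular T0.
have mS n N := measurable_survp hS v n N.
split.
  have a1v : (fun n => a1 n * `|one v|) @ \oo --> (0 : R).
    by rewrite -(mul0r `|one v|); apply: cvgMl.
  (* The function [one] is dominated with constant [C3]; below, [phi 0] is dominated by itself with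
     constant [1]. *)
  have h := survival_cvg hS hC2 Hreg Hinv Hhm Hmur C30 _ a1v (typ_Q_one T0) lamL.
  have {}h : \int[nu S 0 v]_x (ev S (one v) x * \1_(survp S v N N) x) @[N --> \oo]
      --> L * \int[nu S 0 v]_x ev S (one v) x.
    apply: h => x Jx; rewrite oneE indicE mem_set//= ler01.
    exact: (typ_phi0 T0).
  have E A : @measurable _ (Borel X) A -> A `<=` J S v ->
      \int[nu S 0 v]_x (ev S (one v) x * \1_A x) = fine (nu S 0 v A).
    move=> mA AJ.
    have -> : \int[nu S 0 v]_x (ev S (one v) x * \1_A x) = \int[nu S 0 v]_x \1_A x.
      apply: eq_Rintegral => x _; rewrite oneE !indicE.
      case: (boolP (x \in A)); rewrite ?mulr0// => xA.
      by rewrite mem_set ?mulr1//; apply: AJ; rewrite inE in xA.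
    by rewrite /Rintegral integral_indic// setIT.
  have J1 : \int[nu S 0 v]_x ev S (one v) x = 1.
    have -> : \int[nu S 0 v]_x ev S (one v) x =
        \int[nu S 0 v]_x (ev S (one v) x * \1_(J S v) x).
      by apply: eq_Rintegral => x _; rewrite (ev_J hS).
    rewrite E//; last exact: (measurable_J hS).
    have mJ := measurable_J hS v.
    have := measureU0 (mu := nu S 0 v) mJ (measurableC mJ) (nu0_supp (ros_CCM hS) v).
    by rewrite setUv (nu0_prob (ros_CCM hS)) => <-.
  rewrite J1 mulr1 in h; apply: cvg_trans h; apply: near_eq_cvg; near=> N.
  rewrite E//; last by move=> x [].
  rewrite -survpS prednK//; near: N; exact: nbhs_infty_gt.
have h := survival_cvg hS hC2 Hreg Hinv Hhm Hmur ler01 _ a0 (typ_Q_phi0 T0) lamL.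
have {}h : \int[nu S 0 v]_x (ev S (phi S 0 v) x * \1_(survp S v N N) x) @[N --> \oo]
    --> L * \int[nu S 0 v]_x ev S (phi S 0 v) x.
  by apply: h => x Jx; rewrite mul1r lexx (phi0_ge0 hS).
rewrite r1 mulr1 in h; apply: cvg_trans h; apply: near_eq_cvg; near=> N.
rewrite -survpS prednK; last by near: N; exact: nbhs_infty_gt.
by rewrite (muE hC2).
Unshelve. all: by end_near. Qed.

End Point.
End Typical.

(** * Almost every two-sided orbit, and the limit theorem *)

Section AlmostEverywhere.
Context (R : realType) (d : measure_display) (Omega : measurableType d)
  (m : probability Omega R) (X : completePseudoMetricType R)
  (S : open_data Omega X) (hS : random_open_system m S) (hC2 : cond_C2 m S)
  (Q : nat -> forall w, {linear B S w -> B S (sigma S w)}).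

Local Notation sg := (sigma S).
Local Notation sgV := (sigmaV S).

Lemma ae_orbit (P : Omega -> Prop) : {ae m, forall w, P w} ->
  {ae m, forall w, forall k j, P (iter j sg (iter k sgV w))}.
Proof.
move=> aP; have hb := ros_base hS.
have mpV A : measurable A -> m (sgV @^-1` A) = m A.
  move=> mA; have mVA : measurable (sgV @^-1` A).
    by rewrite -[X in measurable X]setTI; exact: (sigmaV_meas hb).
  rewrite -(sigma_mp hb mVA); congr (m _).
  by apply/seteqP; split=> w /=; rewrite (sigmaK hb).
have h := ae_iter (sigma_meas hb) (sigma_mp hb) aP.
exact: (@ae_iter _ _ _ m sgV (sigmaV_meas hb) mpV
  (fun w => forall j, P (iter j sg w)) h).
Qed.

Lemma measurable_scaled_gap N :
  measurable_fun setT (fun w => N%:R * (1 - lam S N w / lam S 0 w)).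
Proof.
apply: measurable_funM; first exact: measurable_cst.
apply: measurable_funB; first exact: measurable_cst.
have mln k : measurable_fun setT (fun w => ln (lam S k w)).
  have [_ [_ [[_ _ h] _]]] := hC2 k.
  exact/measurable_EFinP/(measurable_int m h).
have -> : (fun w => lam S N w / lam S 0 w) =
    (fun w => expR (ln (lam S N w) - ln (lam S 0 w))).
  apply/funext => w; rewrite expRD expRN !lnK// posrE; exact: (lam_gt0 hC2).
apply: measurableT_comp; first exact: measurable_expR.
exact: measurable_funB.
Qed.

End AlmostEverywhere.

Theorem theoremB (R : realType) (d : measure_display) (Omega : measurableType d)
    (m : probability Omega R) (X : completePseudoMetricType R)
    (hX : hausdorff_space X) (S : open_data Omega X)
    (Q : nat -> forall w, {linear B S w -> B S (sigma S w)}) (t : Omega -> R)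
    (hS : random_open_system m S) (hz : exceedance_thresholds m S)
    (hC1 : cond_C1' m S) (hC2 : cond_C2 m S) (hC3 : cond_C3 m Q)
    (hC4 : cond_C4' m Q) (hC5 : cond_C5' m S) (hC7 : cond_C7' m S)
    (hC8 : cond_C8 m S) (ht : cond_S m S t) :
  let L : R := expR (- \int[m]_w (t w * theta0 S w)) in
  {ae m, forall w,
    [/\ (fun N => fine (nu S 0 w (surv S w N.-1 N))) @ \oo --> L,
        (fun N => fine (mu S w (surv S w N.-1 N))) @ \oo --> L &
        (fun N => lamn S N w N / lamn S N w 0) @ \oo --> L]}.
Proof.
move=> L.
have hb := ros_base hS.
have [tL [t0 [xi [W [_ hmu hxi hW]]]]] := ht.
have [M M0 tM] := Lfun_infty_ae_bound tL.
have [C2 [C21 h5]] := hC5.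
have C20 : 0 <= C2 by exact: le_trans C21.
have [C3 [C31 [N0 _ hN0]]] := hC7.
have C30 : 0 < C3 by exact: lt_le_trans C31.
pose one w := projT1 (cid (one_in (ros_spaces hS) w)).
have oneE w : ev S (one w) = \1_(J S w) by rewrite /one; case: cid.
have [Cf [alpha [Cf0 alpha0 alphaoo hphi]]] := hC4 (phi S 0).
have [Cf1 [alpha1 [Cf10 alpha10 alpha1oo hone]]] := hC4 one.
(* The shift meets the requirement of at least one step in [cond_C4']; [C2] bounds the norm of
   [phi 0 w], which makes [a] independent of [w]. *)
pose a n := Cf * alpha n.+1 * C2.
pose a1 n := Cf1 * alpha1 n.+1.
have a0 : a @ \oo --> (0 : R).
  have h0 := summable_cvg0 alpha0 alphaoo.
  have h : Cf * alpha n.+1 * C2 @[n --> \oo] --> (Cf * 0 * C2 : R).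
    by apply: cvgMl; exact: cvgMr.
  by rewrite mulr0 mul0r in h.
have a10 : a1 @ \oo --> (0 : R).
  have h0 := summable_cvg0 alpha10 alpha1oo.
  have h : Cf1 * alpha1 n.+1 @[n --> \oo] --> (Cf1 * 0 : R) by exact: cvgMr.
  by rewrite mulr0 in h.
have hphi0 : {ae m, forall w x, J S w x -> 1 <= C3 * ev S (phi S 0 w) x}.
  have [/ess_infP h _] := hN0 N0 (leqnn _).
  apply: filterS h => w h x Jx.
  have : (C3^-1%:E <= (ev S (phi S 0 w) x)%:E)%E.
    by apply: le_trans h _; apply: ereal_inf_lbound; exists x.
  by rewrite lee_fin -ler_pdivrMl// mulr1.
have hphiN : {ae m, forall w, forall N, (N0 <= N)%N ->
    forall x, J S w x -> 0 <= ev S (phi S N w) x}.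
  apply: ae_foralln => N; have [NN|NN] := leqP N0 N; last exact: aeW.
  have [_ /ess_infP h] := hN0 N NN.
  apply: filterS h => w h _ x Jx; rewrite -lee_fin.
  by apply: le_trans h _; apply: ereal_inf_lbound; exists x.
have typ : {ae m, forall w, typical Q one t xi C2 C3 W M a a1 N0 w}.
  near=> w.
  have hphi5 : (ereal_sup [set Linfty_norm S w (ev S (phi S N w)) | N in [set: nat]]
       <= C2%:E)%E /\ `|phi S 0 w| <= C2 by near: w; exact: h5.
  split.
  - by near: w; exact: regular_ae.
  - by near: w; exact: (mu_inv (ros_CCM hS)).
  - by near: w; exact: hphi0.
  - by near: w; exact: hphiN.
  - move=> N; apply: le_trans hphi5.1; apply: ereal_sup_ubound.
    by exists N.
  - by near: w; exact: hmu.
  - by near: w; exact: t0.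
  - by near: w; exact: tM.
  - by near: w; exact: hxi.
  - by near: w; exact: hW.
  - move=> n N.
    have h : (ereal_sup [set Linfty_norm S (iter n.+1 (sigma S) w)
        (ev S (Qiter Q N n.+1 (phi S 0 w))) | N in [set: nat]]
        <= (Cf * alpha n.+1 * `|phi S 0 w|)%:E)%E.
      by move: n {N}; near: w; apply: filterS hphi => w + n; exact.
    apply: (@le_trans _ _ (Cf * alpha n.+1 * `|phi S 0 w|)%:E).
      by apply: le_trans h; apply: ereal_sup_ubound; exists N.
    by rewrite lee_fin /a ler_wpM2l ?hphi5.2// mulr_ge0 ?ltW// alpha0.
  - move=> n N.
    have h : (ereal_sup [set Linfty_norm S (iter n.+1 (sigma S) w)
        (ev S (Qiter Q N n.+1 (one w))) | N in [set: nat]]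
        <= (Cf1 * alpha1 n.+1 * `|one w|)%:E)%E.
      by move: n {N}; near: w; apply: filterS hone => w + n; exact.
    by apply: le_trans h; apply: ereal_sup_ubound; exists N.
  - by near: w; exact: hC8.
have {}typ := ae_orbit hS typ.
pose g N w := N%:R * (1 - lam S N w / lam S 0 w).
(* [N] times the [mu]-measure of the hole is [t + xi <= M + W]; passing to [nu 0] costs [C3], and
   [phi N] is at most [C2]. *)
pose G := C2 * C3 * (M + W).
have gapE w N : (forall k j, typical Q one t xi C2 C3 W M a a1 N0
    (iter j (sigma S) (iter k (sigmaV S) w))) -> 1 - lam S N w / lam S 0 w = hole_mass S N w.
  move=> Tw.
  exact: (lam_gap hS hC2 N (typ_regular (Tw 0 0)) (typ_regular (Tw 0 1)))%N.
have gG : {ae m, forall w, forall N, (maxn N0 1 <= N)%N -> `|g N w| <= G}.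
  apply: filterS typ => w Tw N; rewrite geq_max => /andP[NN N1].
  have /andP[h1 h2] := typ_hole_mass_bound hS hC2 C20 (ltW C30) (Tw 0 0)%N NN N1.
  rewrite /g (gapE _ _ Tw) ger0_norm ?mulr_ge0//.
  by rewrite mulrC -ler_pdivlMr// ltr0n.
have gl : {ae m, forall w, g ^~ w @ \oo --> t w * theta0 S w}.
  apply: filterS typ => w Tw.
  exact: (scaled_gap_cvg hS hC2 C20 (ltW C30) a0 Tw).
have := maker (sigma_meas hb) (sigma_mp hb) (sigma_ergodic hb)
  (measurable_scaled_gap hC2) gG gl.
apply: filterS2 typ => w Tw gw.
have lamL : lamn S N w N / lamn S N w 0 @[N --> \oo] --> L.
  (* All points of the orbit are typical with the same constants, so the bound [G / N] on these
     factors is uniform in [j]. *)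
  pose x N j := hole_mass S N (iter j (sigma S) w).
  have xE N j : 1 - lam S N (iter j (sigma S) w) / lam S 0 (iter j (sigma S) w) = x N j.
    exact: (lam_gap hS hC2 N (typ_regular (Tw 0%N j)) (typ_regular (Tw 0%N j.+1))).
  have -> : (fun N => lamn S N w N / lamn S N w 0) =
      (fun N => \prod_(j < N) (1 - x N j)).
    apply/funext => N; rewrite /lamn -prodf_div; apply: eq_bigr => j _.
    by rewrite -xE subKr.
  apply: (@prod_cvg_expR _ _ G).
    near=> N => j.
    apply: (typ_hole_mass_bound hS hC2 C20 (ltW C30) (Tw 0%N j)).
      by near: N; exact: nbhs_infty_ge.
    by near: N; exact: nbhs_infty_gt.
  apply: cvg_trans gw; apply: near_eq_cvg; near=> N.
  have N0' : N%:R != 0 :> R by rewrite pnatr_eq0 -lt0n; near: N; exact: nbhs_infty_gt.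
  rewrite /birkhoff_sum mulr_suml; apply: eq_bigr => j _.
  by rewrite xE mulrAC mulfV// mul1r.
have [h1 h2] := typ_survival_cvg hS hC2 oneE C20 (ltW C30) a0 a10 Tw lamL.
by split.
Unshelve. all: by end_near. Qed.
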